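(* Let $n\in\mathbb{N}$, $n\ge3$, and $\mathbf{h}=(h_0,\dots,h_n)\in\mathbb{N}^{n+1}$. Then for each such $n$ and $\mathbf{h}$ there are only finitely many possible values for the line Chern numbers of a smooth reflexive polytope of dimension $n$ and with $h$-vector $\mathbf{h}$. More precisely, let $$C(n,\mathbf{h}):=\sum_{j=0}^n h_j\Big[6j(j-1)+\frac{5n-3n^2}{2}\Big].$$ Then the following bounds hold for any line Chern number $c_e(f)$ of pairs of distinct adjacent edges $e,f$: $$(3-n)\,C(n,\mathbf{h})-2\le c_e(f)<C(n,\mathbf{h}).$$
   Context: A lattice polytope $\Delta\subset\mathbb{R}^n$ of dimension $n$ (vertices in $\mathbb{Z}^n$) is smooth if at every vertex there are exactly $n$ edges and the primitive integer vectors along these edges form a $\mathbb{Z}$-basis of $\mathbb{Z}^n$. It is reflexive if the origin lies in its interior and its dual polytope is also a lattice polytope. Its $h$-vector is defined by $\sum_{i=0}^n h_i t^i=\sum_{i=0}^n F_i(t-1)^i$ with $F_i$ the number of $i$-dimensional faces. Line Chern numbers of a smooth polytope $\Delta$: for an edge $e$ directed from vertex $p$ to vertex $q$ let $\alpha(e)\in\mathbb{Z}^n$ be the primitive vector in the direction of $e$ (from $p$ to $q$). For distinct edges $e,f$ starting at the vertex $p$, with $e$ joining $p$ to $q$, let $\mathcal{F}$ be the 2-dimensional face containing $e$ and $f$, and let $\nabla_e(f)$ be the unique other edge of $\mathcal{F}$ at $q$, directed away from $q$. Then $\alpha(f)-\alpha(\nabla_e(f))=c_e(f)\,\alpha(e)$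 for a unique integer $c_e(f)$, called a line Chern number of $\Delta$. Distinct adjacent edges are edges $e\ne f$ with the same initial vertex. *)

(* Defs.v *)
From HB Require Import structures.
From mathcomp Require Import all_boot all_order all_algebra finmap.
From mathcomp Require Import boolp classical_sets cardinality reals topology.
From mathcomp Require Import normedtype convex.

Set Implicit Arguments.
Unset Strict Implicit.
Unset Printing Implicit Defensive.

Import Order.TTheory GRing.Theory Num.Theory.
Import numFieldNormedType.Exports.

Local Open Scope classical_set_scope.
Local Open Scope ring_scope.

Section Polytopes.
Context {R : realType} {n : nat}.
Implicit Types (A P F : set 'rV[R]_n) (p q r s x y : 'rV[R]_n).

Definition dot x y : R := \sum_(i < n) x 0 i * y 0 i.

Definition lattice_vec (z : 'rV[int]_n) : 'rV[R]_n := map_mx intr z.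

Definition convex_hull A : set 'rV[R]_n := smallest (@convex_set R 'rV[R]_n) A.

Definition is_polytope P : Prop :=
  exists2 A : set 'rV[R]_n, finite_set A & P = convex_hull A.

(* [p + U] is the affine hull of [A]: [U] is the least subspace containing all
   the differences [x - p], [x] in [A]. The empty set has no dimension. *)
Definition has_dim A (d : nat) : Prop :=
  exists p (U : {vspace 'rV[R]_n}),
    [/\ A p, \dim U = d &
        forall W : {vspace 'rV[R]_n},
          (U <= W)%VS <-> (forall x, A x -> x - p \in W)].

(* The choice [a = 0], [b = 0] makes [P] a face of itself; the empty face is
   excluded by [has_dim]. *)
Definition is_face P (d : nat) F : Prop :=
  has_dim F d /\
  exists (a : 'rV[R]_n) (b : R),
    (forall x, P x -> dot a x <= b) /\ F = P `&` [set x | dot a x = b].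

Definition is_vertex P p : Prop := is_face P 0 [set p].

(* The edge with end points [p] and [q], directed from [p] to [q]; that [p]
   and [q] differ is forced by the dimension. *)
Definition is_edge P p q : Prop := is_face P 1 (convex_hull [set p; q]).

Definition is_lattice_polytope P : Prop :=
  is_polytope P /\
  forall p, is_vertex P p -> exists z : 'rV[int]_n, p = lattice_vec z.

Definition is_primitive (a : 'rV[int]_n) : Prop :=
  \big[gcdn/0%N]_(i < n) absz (a 0 i) = 1%N.

Definition primitive_along p q (a : 'rV[int]_n) : Prop :=
  is_primitive a /\ exists2 t : R, 0 < t & q - p = t *: lattice_vec a.

Definition rows_Zbasis (B : 'M[int]_n) : Prop :=
  forall v : 'rV[int]_n, exists! c : 'rV[int]_n,
    v = \sum_(i < n) c 0 i *: row i B.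

Definition is_smooth P : Prop :=
  [/\ is_lattice_polytope P, has_dim P n &
      forall p, is_vertex P p ->
        exists (q : 'I_n -> 'rV[R]_n) (B : 'M[int]_n),
          [/\ injective q,
              forall r, is_edge P p r <-> exists i, r = q i,
              forall i, primitive_along p (q i) (row i B) &
              rows_Zbasis B]].

Definition dual_polytope P : set 'rV[R]_n :=
  [set y | forall x, P x -> - 1 <= dot y x].

Definition is_reflexive P : Prop :=
  [/\ is_lattice_polytope P, interior P 0
    & is_lattice_polytope (dual_polytope P)].

Definition face_count P (i : nat) : nat :=
  #|` fset_set [set F | is_face P i F] |%fset.

Definition has_h_vector P (h : 'I_n.+1 -> nat) : Prop :=
  \sum_(i < n.+1) (h i)%:R *: 'X^i
  = \sum_(i < n.+1) (face_count P i)%:R *: ('X - 1) ^+ i :> {poly int}.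

(* [c] is the line Chern number c_e(f) for the edges e from [p] to [q] and f
   from [p] to [r]; the edge nabla_e(f) goes from [q] to [s]. *)
Definition is_line_chern P p q r (c : int) : Prop :=
  exists (F : set 'rV[R]_n) s (ae af ag : 'rV[int]_n),
    [/\ [/\ is_edge P p q, is_edge P p r & q <> r],
        [/\ is_face P 2 F, convex_hull [set p; q] `<=` F
          & convex_hull [set p; r] `<=` F],
        [/\ is_edge P q s, convex_hull [set q; s] `<=` F & s <> p],
        [/\ primitive_along p q ae, primitive_along p r af
          & primitive_along q s ag] &
        af - ag = c *: ae].

End Polytopes.

Definition chern_bound (n : nat) (h : 'I_n.+1 -> nat) : rat :=
  \sum_(j < n.+1) (h j)%:R *
    (6 * j%:R * (j%:R - 1) + (5 * n%:R - 3 * n%:R ^+ 2) / 2).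

(* Main.v *)
Require Import Defs.
From mathcomp Require Import all_boot all_order all_algebra finmap.
From mathcomp Require Import boolp classical_sets cardinality reals topology.
From mathcomp Require Import normedtype convex interval_inference.
From mathcomp Require Import ring lra zify.

(* Let [c(e,f)] be the line Chern numbers, with the convention [c(e,e) = 2].
   In a smooth reflexive polytope every vertex is minus the sum of the
   primitive edge vectors at it, so the lattice length of an edge [e] is
   [\sum_f c(e,f)], the sum over all edges at its initial vertex.  The end
   point of [nabla_e f] stays in the cone spanned by the edges at the initial
   vertex of [e], hence [c(e,f) <= length e], and the length formula then turns
   these upper bounds into a lower bound.  It remains to see that the sum of the
   lengths of all edges is [C(n,h)].

   For an integral functional [xi] not vanishing on edges, the involution
   [(e,f) -> (-e, nabla_e f)] gives
   [\sum c(e,f) = \sum (xi f / xi e + xi e / xi f)], both sums over pairs of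
   edges at a common vertex.  By Dedekind reciprocity
   [x / y + y / x = 3 sgn (x y) - gcd(x,y)^2 / (x y) + s(x,y) + s(y,x)], where
   [s(x,y)] is odd in [y] and depends on [x] only modulo [y]; so its sum is odd
   under the involution and vanishes.  The sum of [gcd^2 / (x y)] is evaluated
   in a similar way.  The sum of the signs is expressed by the number [k] of
   edges descending at each vertex, and a face of dimension [d] is the same as a
   vertex (its top) with [d] of its descending edges. *)

Set Implicit Arguments.
Unset Strict Implicit.
Unset Printing Implicit Defensive.

Import Order.TTheory GRing.Theory Num.Theory.
Import numFieldNormedType.Exports.

Local Open Scope classical_set_scope.
Local Open Scope ring_scope.

(** * Dedekind sums *)

Section Dedekind.

(** The right-hand side of reciprocity for twelve times the classical Dedekind sum, in the form
    valid without coprimality. *)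
Definition ded_step (a b : nat) : rat :=
  a%:R / b%:R + b%:R / a%:R + (gcdn a b)%:R ^+ 2 / (a%:R * b%:R) - 3.

(** Twelve times the Dedekind sum, defined by the Euclidean algorithm instead of sawtooth functions,
    so that reciprocity is nearly built in and oddness is what needs proof. The modulus decreases
    strictly, so [b] is enough fuel. *)
Fixpoint ded_rec (m a b : nat) : rat :=
  if m is m'.+1 then
    let r := (a %% b)%N in if r == 0%N then 0 else ded_step r b - ded_rec m' b r
  else 0.

Definition ded (a b : nat) : rat := ded_rec b a b.

Lemma ded_recE m a b : (0 < b <= m)%N -> ded_rec m a b = ded a b.
Proof.
rewrite /ded; elim/ltn_ind: m a b => m IH a [//|b] /=.
case: m IH => [//|m] IH; rewrite ltnS /= => bm.
case: eqP => // /eqP; rewrite -lt0n => r_gt0.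
have rb : (a %% b.+1 <= b)%N by rewrite -ltnS ltn_mod.
by rewrite (IH m) ?r_gt0 ?(leq_trans rb) // (IH b) ?r_gt0.
Qed.

Lemma dedE a b : (0 < b)%N ->
  ded a b = if (a %% b == 0)%N then 0 else ded_step (a %% b) b - ded b (a %% b).
Proof.
case: b => // b _; rewrite {1}/ded /=; case: eqP => // /eqP r0.
by rewrite ded_recE // lt0n r0 -ltnS ltn_mod.
Qed.

Lemma ded_modl a b : (0 < b)%N -> ded (a %% b) b = ded a b.
Proof. by move=> b0; rewrite dedE // [RHS]dedE // modn_mod. Qed.

Lemma ded_addl a b : (0 < b)%N -> ded (a + b) b = ded a b.
Proof. by move=> b0; rewrite -ded_modl // modnDr ded_modl. Qed.

Lemma ded_stepC a b : ded_step a b = ded_step b a.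
Proof. by rewrite /ded_step gcdnC [b%:R * a%:R]mulrC [b%:R / _ + _]addrC. Qed.

Lemma ded0 b : ded 0 b = 0.
Proof. by case: b => // b; rewrite dedE // mod0n. Qed.

(** For a < b this is one unfolding of the recursion; for a = b both sides are 0, as 1 + 1 + 1 - 3 =
    0. *)
Lemma ded_recip a b : (0 < a)%N -> (0 < b)%N -> ded a b + ded b a = ded_step a b.
Proof.
wlog ab : a b / (a <= b)%N.
  move=> W a0 b0; case: (leqP a b) => [|/ltnW] ab; first exact: W.
  by rewrite addrC ded_stepC W.
move=> a0 b0; move: ab; rewrite leq_eqVlt => /predU1P[<-|ab].
  rewrite dedE // modnn eqxx addr0 /ded_step gcdnn -expr2.
  by rewrite !divff ?expf_neq0 ?pnatr_eq0 -?lt0n.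
rewrite dedE // modn_small // eqn0Ngt a0 /=; ring.
Qed.

(* Two steps of the Euclidean recursion on each side; no induction. *)
Lemma ded_oddl a b : (a <= b)%N -> ded (b - a) b = - ded a b.
Proof.
wlog lab : a / (a <= b - a)%N.
  move=> W ab; case: (leqP a (b - a)) => [|lt]; first by move/W; apply.
  have := W (b - a)%N; rewrite subKn // => ->; rewrite ?opprK ?leq_subr //; exact: ltnW.
case: a lab => [|a] lab ab.
  by rewrite subn0 ded0 oppr0; case: b {lab ab} => // b; rewrite dedE // modnn.
have [c bE] : {c | b = (a.+1 + c)%N} by exists (b - a.+1)%N; rewrite subnKC.
subst b; rewrite addKn in lab *; have c0 : (0 < c)%N by case: c lab {ab}.
have nz : (a.+1%:R != 0 :> rat) /\ (c%:R != 0 :> rat) /\ ((a.+1 + c)%:R != 0 :> rat).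
  by rewrite !pnatr_eq0 -!lt0n c0.
have [nza [nzc nzb]] := nz.
have e1 := @ded_recip c (a.+1 + c) c0 isT.
have e2 := @ded_recip a.+1 (a.+1 + c) isT isT.
have e3 := @ded_recip a.+1 c isT c0.
rewrite ded_addl // in e1; rewrite addnC ded_addl // in e2.
(* Three reciprocities express everything through [ded c a.+1], which cancels; an identity between
   three values of [ded_step] remains. *)
have -> : ded c (a.+1 + c) = ded_step c (a.+1 + c) - ded a.+1 c by rewrite -e1; ring.
rewrite addnC.
have -> : ded a.+1 (c + a.+1) = ded_step a.+1 (c + a.+1) - ded c a.+1 by rewrite -e2; ring.
have -> : ded a.+1 c = ded_step a.+1 c - ded c a.+1 by rewrite -e3; ring.
have g1 : gcdn c (c + a.+1) = gcdn a.+1 c by rewrite gcdnDl gcdnC.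
have g2 : gcdn a.+1 (c + a.+1) = gcdn a.+1 c by rewrite gcdnDr.
rewrite addnC natrD in nzb.
rewrite /ded_step g1 g2 natrD; move: nza nzc nzb.
move: (a.+1%:R : rat) (c%:R : rat) => x y x0 y0 xy0.
by field; rewrite xy0 x0 y0.
Qed.

(** The sign factor makes the function odd in each argument, like the other terms of reciprocity,
    which therefore extends to all nonzero integers. *)
Definition dedz (a b : int) : rat := (sgz a * sgz b)%:~R * ded `|a|%N `|b|%N.

Lemma dedzN a b : dedz a (- b) = - dedz a b.
Proof. by rewrite /dedz sgzN mulrN abszN rmorphN mulNr. Qed.

Lemma dedz_recip a b : a != 0 -> b != 0 ->
  dedz a b + dedz b a = a%:~R / b%:~R + b%:~R / a%:~R
     + (gcdz a b)%:~R ^+ 2 / (a%:~R * b%:~R) - 3 * (sgz a * sgz b)%:~R.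
Proof.
move=> a0 b0; rewrite /dedz [sgz b * _]mulrC -mulrDr ded_recip ?absz_gt0 //.
rewrite /ded_step /gcdz.
have E (x : int) : x != 0 -> exists2 s : rat, s = 1 \/ s = -1 &
    x%:~R = s * `|x|%N%:R /\ (sgz x)%:~R = s.
  move=> x0; exists (sgz x)%:~R; last first.
    by split => //; rewrite -[(absz x)%:R]/((absz x)%:Z%:~R) -rmorphM /= -intEsg.
  by case: sgzP x0; [|left|right].
have na : (`|a|%N%:R != 0 :> rat) by rewrite pnatr_eq0 absz_eq0.
have nb : (`|b|%N%:R != 0 :> rat) by rewrite pnatr_eq0 absz_eq0.
have [s s2 [-> sE]] := E _ a0; have [t t2 [-> tE]] := E _ b0.
rewrite rmorphM /= sE tE; move: na nb.
move: (`|a|%N%:R : rat) (`|b|%N%:R : rat) => x y x0 y0.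
by case: s2 => ->; case: t2 => ->; field; rewrite ?x0 ?y0 ?oppr_eq0.
Qed.

Lemma dedNz a b : dedz (- a) b = - dedz a b.
Proof. by rewrite /dedz sgzN mulNr abszN rmorphN mulNr. Qed.

Lemma dedz_nat (a b : nat) : (0 < b)%N -> dedz a b = ded a b.
Proof.
move=> b0; rewrite /dedz !absz_nat; case: a => [|a]; first by rewrite ded0 mulr0.
by rewrite !gtr0_sgz ?ltz_nat // mulr1 mul1r.
Qed.

Lemma dedz_addl a b : dedz (a + b) b = dedz a b.
Proof.
wlog b0 : a b / 0 < b.
  move=> W; case: (ltrgtP b 0) => [b0|b0|->]; last by rewrite addr0.
    apply/eqP; rewrite -eqr_opp -!dedzN -(W (a + b) (- b)) ?oppr_gt0 //.
    by rewrite addrK.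
  exact: W.
case: b b0 => // b b0; rewrite ltz_nat in b0.
have [a0|/ltW a0] := lerP 0 a.
  by case: a a0 => // a _; rewrite -PoszD !dedz_nat // ded_addl.
(* For negative first argument the shift by b may cross 0; there [ded_oddl] compares the two sides,
   otherwise periodicity is enough. *)
rewrite -[a]opprK; move: a0; rewrite -oppr_ge0; case: (- a) => // {}a _.
rewrite dedNz dedz_nat // addrC; have [ab|/ltnW ba] := leqP a b.
  by rewrite subzn // dedz_nat // ded_oddl.
by rewrite -opprB subzn // dedNz dedz_nat // -[in RHS](subnK ba) ded_addl.
Qed.

Lemma dedz_addMl a b c : dedz (a + c * b) b = dedz a b.
Proof.
elim: c => [|c IH|c IH]; first by rewrite mul0r addr0.
  by rewrite -addn1 PoszD mulrDl mul1r addrA dedz_addl.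
rewrite -IH -(dedz_addl (a + _)) -addn1 PoszD opprD mulrDl mulN1r addrA.
by rewrite subrK.
Qed.

Lemma dedz_subMl a b c : dedz (a - c * b) b = dedz a b.
Proof. by rewrite -[- (c * b)]mulNr dedz_addMl. Qed.

End Dedekind.

(** * Summation over the edge connection *)

Lemma sum_involution (T : finType) (f : T -> T) (G : T -> rat) :
  involutive f -> (forall t, G (f t) = - G t) -> \sum_t G t = 0.
Proof.
move=> fK fG; have : \sum_t G t = - \sum_t G t; last by lra.
by rewrite {1}(reindex_inj (inv_inj fK)) -sumrN; apply: eq_bigr.
Qed.

(* [nb p i] is the other end of the [i]-th edge at [p], and [nx p i k] is the
   index there of [nabla] of the [k]-th edge along the [i]-th one.  On the
   diagonal, [nx p i i] is the reversed edge, whence [ch p i i = 2]. *)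
Section Connection.
Variables (N n : nat) (nb : 'I_N -> 'I_n -> 'I_N).
Variables (nx : 'I_N -> 'I_n -> 'I_n -> 'I_n) (ch : 'I_N -> 'I_n -> 'I_n -> int).
Hypothesis nbK : forall p i, nb (nb p i) (nx p i i) = p.
Hypothesis nxK : forall p i k, nx (nb p i) (nx p i i) (nx p i k) = k.
Hypothesis ch_diag : forall p i, ch p i i = 2.

Let triple : finType := ('I_N * ('I_n * 'I_n))%type.
Let flip (t : triple) : triple :=
  let: (p, (i, k)) := t in (nb p i, (nx p i i, nx p i k)).
Let swap (t : triple) : triple := (t.1, (t.2.2, t.2.1)).

Let flipK : involutive flip.
Proof. by case=> p [i k] /=; rewrite nbK !nxK. Qed.

Let swapK : involutive swap. Proof. by case=> p [i k]. Qed.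

Variables x y : 'I_N -> 'I_n -> int.
Hypothesis xT : forall p i k, x (nb p i) (nx p i k) = x p k - ch p i k * x p i.
Hypothesis yT : forall p i k, y (nb p i) (nx p i k) = y p k - ch p i k * y p i.
Hypothesis x0 : forall p i, x p i != 0.
Hypothesis xy0 : forall p i k, i != k -> x p i * y p k - x p k * y p i != 0.

Let xN p i : x (nb p i) (nx p i i) = - x p i.
Proof. by rewrite xT ch_diag; ring. Qed.
Let yN p i : y (nb p i) (nx p i i) = - y p i.
Proof. by rewrite yT ch_diag; ring. Qed.

Let a (t : triple) := x t.1 t.2.1.
Let b (t : triple) := x t.1 t.2.2.
(** The determinant of the values of the two functionals on the two edges. It is odd under [flip],
    which acts on these values by a matrix of determinant -1. *)
Let D (t : triple) : int := a t * y t.1 t.2.2 - b t * y t.1 t.2.1.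
Let g (t : triple) : int := gcdz (a t) (b t).

Let a_neq0 t : (a t)%:~R != 0 :> rat. Proof. by rewrite intr_eq0 x0. Qed.
Let aF t : a (flip t) = - a t. Proof. by case: t => p [i k]; exact: xN. Qed.
Let bF t : b (flip t) = b t - ch t.1 t.2.1 t.2.2 * a t.
Proof. by case: t => p [i k]; exact: xT. Qed.

(** Transport along an edge and back is the identity; as [x p i] is nonzero, the two coefficients
    must agree. *)
Let chF p i k : ch (nb p i) (nx p i i) (nx p i k) = ch p i k.
Proof.
have := xT (nb p i) (nx p i i) (nx p i k); rewrite nbK nxK xN (xT p i k) => e.
by apply: (mulIf (x0 p i)); lra.
Qed.

(** The quotients [b / a] at [t] and at [flip t] add up to the Chern number at [t], and [swap]
    symmetrizes their sum. *)
Let sum_ch : \sum_t (ch t.1 t.2.1 t.2.2)%:~R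
  = \sum_t ((a t)%:~R / (b t)%:~R + (b t)%:~R / (a t)%:~R) :> rat.
Proof.
have swapE : \sum_t ((a t)%:~R / (b t)%:~R) = \sum_t (b t)%:~R / (a t)%:~R :> rat.
  by rewrite (reindex_inj (inv_inj swapK)).
rewrite big_split /= swapE; apply/eqP; rewrite -subr_eq0 -big_split -sumrB /=.
rewrite (@sum_involution _ flip) // => t; rewrite aF bF.
have -> : ch (flip t).1 (flip t).2.1 (flip t).2.2 = ch t.1 t.2.1 t.2.2.
  by case: t => p [i k] /=; rewrite chF.
by rewrite rmorphB rmorphM rmorphN /=; field; rewrite ?oppr_eq0 a_neq0.
Qed.

Let sum_ded : \sum_t (dedz (a t) (b t) + dedz (b t) (a t)) = 0.
Proof.
have -> : \sum_t (dedz (a t) (b t) + dedz (b t) (a t))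
    = \sum_t (dedz (b t) (a t) + dedz (b t) (a t)).
  by rewrite !big_split /=; congr (_ + _); rewrite (reindex_inj (inv_inj swapK)).
rewrite (@sum_involution _ flip) // => t; rewrite aF bF dedzN dedz_subMl.
by rewrite opprD.
Qed.

Let gF t : g (flip t) = g t.
Proof.
by rewrite /g aF bF -mulNr /gcdz abszN -/(gcdz _ _) addrC gcdzMDl.
Qed.

Let DF t : D (flip t) = - D t.
Proof.
case: t => p [i k]; rewrite /D aF bF /= yN yT /a /=; ring.
Qed.

(* The weight [(y i / x i) / D] is odd under [flip], and its symmetrization
   under [swap] is [- 1 / (x i * x k)]; [D] vanishes on the diagonal. *)
Let sum_gcd : \sum_t (g t)%:~R ^+ 2 / ((a t)%:~R * (b t)%:~R) = (N * n)%:R :> rat.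
Proof.
pose G t : rat := (g t)%:~R ^+ 2 * ((y t.1 t.2.1)%:~R / (a t)%:~R) / (D t)%:~R.
have G0 : \sum_t G t = 0.
  apply: (@sum_involution _ flip) => // t; rewrite /G aF DF gF.
  have -> : y (flip t).1 (flip t).2.1 = - y t.1 t.2.1 by case: t => p [i k] /=.
  by rewrite !rmorphN /= invrN !(mulrN, mulNr, invrN, opprK).
have G2 : \sum_t (G t + G (swap t)) = 0.
  by rewrite big_split /= G0 add0r; move: G0; rewrite (reindex_inj (inv_inj swapK)).
(* On the diagonal the summand is 1, whereas [G] is 0 because the inverse of [D = 0] is 0; the
   Kronecker delta supplies these [N * n] ones. *)
transitivity (\sum_t ((t.2.1 == t.2.2)%:R - (G t + G (swap t)))); last first.
  rewrite sumrB G2 subr0.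
  rewrite -(pair_bigA _ (fun p q => (q.1 == q.2)%:R)) /=.
  rewrite sumr_const card_ord mulnC natrM -[LHS]mulr_natr. congr (_ * _).
  rewrite -(pair_bigA _ (fun i k => (i == k)%:R)) /=.
  under eq_bigr => i _.
    rewrite (bigD1 i) //= eqxx big1 ?addr0; last by move=> k; rewrite eq_sym => /negPf->.
  over.
  by rewrite sumr_const card_ord.
apply: eq_bigr => -[p [i k]] _ /=; rewrite /G /D /g /a /b /=.
have xk : (x p k)%:~R != 0 :> rat by rewrite intr_eq0.
have xi : (x p i)%:~R != 0 :> rat by rewrite intr_eq0.
case: eqVneq => [<-|ik].
  rewrite subrr invr0 !mulr0 addr0 /gcdz gcdnn.
  by rewrite abszE intr_norm real_normK ?num_real // -expr2 divff // expf_neq0.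
have d1 : (x p i)%:~R * (y p k)%:~R - (x p k)%:~R * (y p i)%:~R != 0 :> rat.
  by rewrite -!rmorphM -rmorphB intr_eq0 xy0.
rewrite gcdzC !rmorphB !rmorphM /=; field.
by rewrite xk xi d1 -opprB oppr_eq0 d1.
Qed.

(** By reciprocity the symmetrized quotients split into Dedekind terms, which cancel, the gcd terms,
    which sum to [N * n], and products of signs, which at each vertex sum to a square. *)
Lemma sum_connection :
  \sum_(p < N) \sum_(i < n) \sum_(k < n) (ch p i k)%:~R
  = \sum_(p < N) (3 * (\sum_(i < n) sgz (x p i))%:~R ^+ 2 - n%:R) :> rat.
Proof.
transitivity (\sum_t (ch t.1 t.2.1 t.2.2)%:~R : rat).
  rewrite -(pair_bigA _ (fun p q => (ch p q.1 q.2)%:~R)) /=; apply: eq_bigr => p _.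
  by rewrite -(pair_bigA _ (fun i k => (ch p i k)%:~R)).
rewrite sum_ch.
transitivity (\sum_t (dedz (a t) (b t) + dedz (b t) (a t)
    - (g t)%:~R ^+ 2 / ((a t)%:~R * (b t)%:~R) + 3 * (sgz (a t) * sgz (b t))%:~R)).
  by apply: eq_bigr => t _; rewrite dedz_recip //; try ring; exact: x0.
rewrite big_split sumrB /= sum_ded sum_gcd sub0r sumrB sumr_const card_ord.
rewrite addrC -[n%:R *+ N]mulr_natr mulnC natrM; congr (_ - _).
rewrite -mulr_sumr -[RHS]mulr_sumr; congr (_ * _).
rewrite -(pair_bigA _ (fun p q => (sgz (x p q.1) * sgz (x p q.2))%:~R)) /=.
apply: eq_bigr => p _.
rewrite -(pair_bigA _ (fun i k => (sgz (x p i) * sgz (x p k))%:~R)) /=.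
rewrite -rmorphXn /= expr2 mulr_suml rmorph_sum /=; apply: eq_bigr => i _.
by rewrite mulr_sumr rmorph_sum.
Qed.

End Connection.

(** * Convexity and Gordan's lemma *)

Section Dot.
Context {R : realType} {n : nat}.
Implicit Types x y z : 'rV[R]_n.

Lemma dotE x y : dot x y = (x *m y^T) 0 0.
Proof. by rewrite mxE; apply: eq_bigr => i _; rewrite mxE. Qed.

Lemma dotC x y : dot x y = dot y x.
Proof. by apply: eq_bigr => i _; rewrite mulrC. Qed.

Lemma dotDr x y z : dot x (y + z) = dot x y + dot x z.
Proof. by rewrite !dotE linearD mulmxDr mxE. Qed.

Lemma dotZr (t : R) x y : dot x (t *: y) = t * dot x y.
Proof. by rewrite !dotE linearZ -scalemxAr mxE. Qed.

Lemma dotNr x y : dot x (- y) = - dot x y.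
Proof. by rewrite -scaleN1r dotZr mulN1r. Qed.

Lemma dotBr x y z : dot x (y - z) = dot x y - dot x z.
Proof. by rewrite dotDr dotNr. Qed.

Lemma dotDl x y z : dot (x + y) z = dot x z + dot y z.
Proof. by rewrite ![dot _ z]dotC dotDr. Qed.

Lemma dotZl (t : R) x y : dot (t *: x) y = t * dot x y.
Proof. by rewrite ![dot _ y]dotC dotZr. Qed.

Lemma dotNl x y : dot (- x) y = - dot x y.
Proof. by rewrite ![dot _ y]dotC dotNr. Qed.

Lemma dotBl x y z : dot (x - y) z = dot x z - dot y z.
Proof. by rewrite dotDl dotNl. Qed.

Lemma dot0r x : dot x 0 = 0.
Proof. by rewrite -(scale0r 0) dotZr mul0r. Qed.

Lemma dot_sumr (I : finType) (P : pred I) x (F : I -> 'rV[R]_n) :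
  dot x (\sum_(i | P i) F i) = \sum_(i | P i) dot x (F i).
Proof. exact: (big_morph _ (dotDr x) (dot0r x)). Qed.

Lemma dot_suml (I : finType) (P : pred I) x (F : I -> 'rV[R]_n) :
  dot (\sum_(i | P i) F i) x = \sum_(i | P i) dot (F i) x.
Proof. by rewrite dotC dot_sumr; apply: eq_bigr => i _; rewrite dotC. Qed.

Lemma dot_gt0 x : x != 0 -> 0 < dot x x.
Proof.
move=> x0; rewrite lt_def sumr_ge0 ?andbT => [|i _]; last by rewrite -expr2 sqr_ge0.
apply: contraNneq x0 => /psumr_eq0P e; apply/eqP/rowP => i.
by rewrite mxE; apply/eqP; rewrite -sqrf_eq0 expr2 e // => j _; rewrite -expr2 sqr_ge0.
Qed.

End Dot.

Section Hull.
Context {R : realType} {n : nat}.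
Implicit Types (A C : set 'rV[R]_n) (x y : 'rV[R]_n).

(** Convexity with a plain real parameter in place of the interval-typed one of [convex_set]. *)
Definition closed_segments C := forall x y (t : R),
  C x -> C y -> 0 <= t -> t <= 1 -> C (t *: x + (1 - t) *: y).

Lemma hull_min A C : closed_segments C -> A `<=` C -> convex_hull A `<=` C.
Proof.
move=> Cseg AC x; apply; split=> // y z t /set_mem Cy /set_mem Cz; apply/mem_set.
by apply: Cseg.
Qed.

Lemma sub_hull A : A `<=` convex_hull A.
Proof. by move=> x Ax C [_]; apply. Qed.

Lemma hull_segments A : closed_segments (convex_hull A).
Proof.
move=> x y t xA yA t0 t1 C [Cconv AC].
have := @Cconv x y (Itv01 t0 t1)
  (mem_set (xA _ (conj Cconv AC))) (mem_set (yA _ (conj Cconv AC))).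
by move/set_mem.
Qed.

Lemma hull_sub A B : A `<=` convex_hull B -> convex_hull A `<=` convex_hull B.
Proof. exact: hull_min (hull_segments (A := B)). Qed.

Lemma hull_sum m A (u : 'I_m -> 'rV[R]_n) (c : 'I_m -> R) :
  (forall i, A (u i)) -> (forall i, 0 <= c i) -> \sum_i c i = 1 ->
  convex_hull A (\sum_i c i *: u i).
Proof.
elim: m u c => [|m IH] u c uA c0 c1.
  by move/eqP: c1; rewrite big_ord0 eq_sym oner_eq0.
rewrite big_ord_recl; rewrite big_ord_recl in c1.
have c01 : c ord0 <= 1 by rewrite -c1 lerDl sumr_ge0.
(* The remaining weights are rescaled by [1 - c ord0]; if this is 0, they all vanish. *)
have [e|ne] := eqVneq (c ord0) 1.
  have /psumr_eq0P z : \sum_i c (lift ord0 i) = 0 by lra.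
  rewrite big1 ?addr0 ?e ?scale1r; first exact: sub_hull.
  by move=> i _; rewrite z ?scale0r.
have d0 : 1 - c ord0 != 0 by rewrite subr_eq0 eq_sym.
have := IH (fun i => u (lift ord0 i)) (fun i => c (lift ord0 i) / (1 - c ord0)).
move=> /(_ (fun i => uA _)) H.
have -> : \sum_i c (lift ord0 i) *: u (lift ord0 i) =
    (1 - c ord0) *: \sum_i (c (lift ord0 i) / (1 - c ord0)) *: u (lift ord0 i).
  by rewrite scaler_sumr; apply: eq_bigr => i _; rewrite scalerA mulrC divfK.
apply: hull_segments => //; first exact: sub_hull.
apply: H => [i|]; first by rewrite divr_ge0 // subr_ge0.
by rewrite -mulr_suml; apply: (canLR (mulfK d0)); lra.
Qed.

Lemma hull_pair x y z : convex_hull [set x; y] z <->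
  exists t : R, [/\ 0 <= t, t <= 1 & z = x + t *: (y - x)].
Proof.
split.
  pose C := [set z | exists t : R, [/\ 0 <= t, t <= 1 & z = x + t *: (y - x)]].
  apply: (@hull_min _ C) z => [z w t [s [s0 s1 ->]] [r [r0 r1 ->]] t0 t1|z [->|->]].
  - exists (t * s + (1 - t) * r); split; [nra|nra|].
    have e : t *: x + (1 - t) *: x = x by rewrite -scalerDl addrC subrK scale1r.
    by move: (y - x) => d; rewrite !scalerDr !scalerA addrACA e -scalerDl.
  - by exists 0; rewrite scale0r addr0.
  - by exists 1; rewrite scale1r addrC subrK.
case=> t [t0 t1 ->].
have -> : x + t *: (y - x) = t *: y + (1 - t) *: x.
  by rewrite scalerBr scalerBl scale1r addrCA addrA.
by apply: hull_segments => //; apply: sub_hull; [right|left].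
Qed.

(** Induction on the number of vectors: a functional positive on all but the first vector [v] is
    tilted if it is non-negative on [v], and otherwise used to project the others along [v]. *)
Lemma gordan m (w : 'I_m -> 'rV[R]_n) :
  (exists l : 'rV[R]_n, forall i, 0 < dot l (w i)) \/
  (exists c : 'I_m -> R, [/\ forall i, 0 <= c i, exists i, 0 < c i &
     \sum_i c i *: w i = 0]).
Proof.
elim: m w => [|m IH] w; first by left; exists 0 => -[].
set v := w ord0; pose u i := w (lift ord0 i).
have [v0|v0] := eqVneq v 0.
  right; exists (fun i => (i == ord0)%:R); split=> [i||]; rewrite ?ler0n //.
    by exists ord0; rewrite eqxx ltr01.
  rewrite big_ord_recl eqxx scale1r -/v v0 add0r big1 // => i _.
  by rewrite eq_sym (negPf (neq_lift _ _)) scale0r.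
have ext (c : 'I_m -> R) d : (forall i, 0 <= c i) -> 0 <= d -> (exists i, 0 < c i) ->
    d *: v + \sum_i c i *: u i = 0 -> exists c : 'I_m.+1 -> R,
    [/\ forall i, 0 <= c i, exists i, 0 < c i & \sum_i c i *: w i = 0].
  move=> c0 d0 [i ci] e.
  exists (fun i => if unlift ord0 i is Some j then c j else d); split.
  - by move=> j; case: unliftP.
  - by exists (lift ord0 i); rewrite liftK.
  - rewrite big_ord_recl unlift_none -/v -[RHS]e; congr (_ + _).
    by apply: eq_bigr => j _; rewrite liftK.
case: (IH u) => [[l lu]|[c [c0 cp e]]]; last first.
  by right; apply: (ext c 0) => //; rewrite scale0r add0r.
(* Tilting [l'] towards [v] keeps the finitely many strict inequalities. *)
have tilt (l' : 'rV[R]_n) : (forall i, 0 < dot l' (u i)) -> 0 <= dot l' v ->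
    exists l : 'rV[R]_n, forall i, 0 < dot l (w i).
  move=> l'u l'v; have [d d0 dP] : exists2 d : R, 0 < d &
      forall i, 0 < dot (l' + d *: v) (u i).
    pose M : R := 1 + \sum_i `|dot v (u i)| / dot l' (u i).
    have M0 : 0 < M by rewrite ltr_pwDl // sumr_ge0 // => i _; rewrite divr_ge0 // ltW.
    exists M^-1; rewrite ?invr_gt0 // => i; rewrite dotDl dotZl.
    have : `|dot v (u i)| < M * dot l' (u i).
      rewrite -ltr_pdivrMr // /M (bigD1 i) //= addrCA ltrDl.
      by rewrite ltr_pwDl // sumr_ge0 // => j _; rewrite divr_ge0 // ltW.
    rewrite ltr_norml => /andP[H _].
    have : 0 < M * (dot l' (u i) + M^-1 * dot v (u i)).
      by rewrite mulrDr mulVKf ?gt_eqF //; lra.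
    by rewrite pmulr_rgt0.
  exists (l' + d *: v) => i; case: (unliftP ord0 i) => [j ->|->]; first exact: dP.
  by rewrite -/v dotDl dotZl ltr_wpDl // mulr_gt0 // dot_gt0.
have [lv|lv] := lerP 0 (dot l v); first by left; apply: tilt lu lv.
(* These are the projections along [v] to the kernel of [l]. A positive functional on them can be
   made to vanish on [v]; a relation between them lifts to one with a non-negative coefficient at
   [v], because [l] is negative on [v] and positive on the [u i]. *)
pose u' i := u i - (dot l (u i) / dot l v) *: v.
case: (IH u') => [[l' l'u]|[c [c0 [i ci] e]]].
  left; apply: (tilt (l' - (dot l' v / dot l v) *: l)) => [i|].
    have := l'u i; rewrite /u' dotBr dotBl !dotZr !dotZl.
    by congr (_ < _); ring.
  by rewrite dotBl dotZl divfK ?lt_eqF // subrr.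
right; apply: (ext c (- (\sum_i c i * dot l (u i)) / dot l v)) => //.
- rewrite mulNr -mulrN -invrN mulr_ge0 ?invr_ge0 ?oppr_ge0 ?(ltW lv) // sumr_ge0 // => j _.
  by rewrite mulr_ge0 // ltW.
- by exists i.
rewrite -[RHS]e /u'.
under [RHS]eq_bigr => j _ do rewrite scalerBr scalerA.
rewrite sumrB -scaler_suml addrC -scaleNr; congr (_ + _ *: v).
by rewrite mulNr mulr_suml; congr (- _); apply: eq_bigr => j _; rewrite mulrA.
Qed.

End Hull.

(** * Vertices and edges of polytopes *)

Section Faces.
Context {R : realType} {n : nat}.
Implicit Types (P A K F : set 'rV[R]_n) (p q r x y l : 'rV[R]_n).

Lemma has_dim_uniq A d d' : has_dim A d -> has_dim A d' -> d = d'.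
Proof.
suff W : forall d d', has_dim A d -> has_dim A d' -> (d <= d')%N.
  by move=> h h'; apply/eqP; rewrite eqn_leq !W.
move=> {}d {}d' [p [U [Ap <- HU]]] [q [V [Aq <- HV]]].
apply: dimvS; apply/HU => x Ax.
have V1 := (HV V).1 (subvv _).
by rewrite -(subrK q x) -addrA rpredD ?V1 // -opprB rpredN V1.
Qed.

Lemma has_dim_point x : has_dim [set x] 0.
Proof.
exists x, 0%VS; split=> //; first exact: dimv0.
by move=> W; split=> [_ y ->|_]; rewrite ?subrr ?mem0v ?sub0v.
Qed.

Lemma has_dim_segment p q : p != q -> has_dim (convex_hull [set p; q]) 1.
Proof.
move=> pq; exists p, <[q - p]>%VS; split.
- by apply: sub_hull; left.
- by rewrite dim_vline subr_eq0 eq_sym pq.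
move=> W; rewrite -memvE; split=> [Wqp x /hull_pair[t [_ _ ->]]|]; last first.
  by apply; apply: sub_hull; right.
by rewrite addrC addKr memvZ.
Qed.

Lemma vertexP P p : is_vertex P p <->
  P p /\ exists l, forall x, P x -> x = p \/ dot l p < dot l x.
Proof.
split=> [[_ [a [b [Pab e]]]]|[Pp [l H]]].
  have [Pp ap] : (P `&` [set x | dot a x = b]) p by rewrite -e.
  split=> //; exists (- a) => x Px; rewrite !dotNl ltrN2 ap.
  have := Pab x Px; rewrite le_eqVlt => /predU1P[ax|]; last by right.
  by left; suff : [set p] x by []; rewrite e.
split; first exact: has_dim_point.
exists (- l), (- dot l p); split=> [x Px|].
  by rewrite dotNl lerN2; case: (H x Px) => [->|/ltW].
apply/seteqP; split=> x; first by move=> ->; split; rewrite //= dotNl.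
by case=> /H[-> //|+]; rewrite /= dotNl => + /oppr_inj e; rewrite e ltxx.
Qed.

(* The half-open shape lets one inequality on the generators decide both
   the supporting hyperplane and the face it cuts out. *)
Lemma closed_segments_face K l (c : R) : closed_segments K ->
  (forall x, K x -> dot l x = c) ->
  closed_segments [set x | K x \/ c < dot l x].
Proof.
move=> Kseg Kl x y t Hx Hy t0 t1; rewrite /= dotDr !dotZr.
have [t_0|tn0] := eqVneq t 0.
  by rewrite t_0 subr0 scale0r scale1r !add0r mul0r mul1r add0r.
have [t_1|tn1] := eqVneq t 1.
  by rewrite t_1 subrr scale0r scale1r !addr0 mul0r mul1r addr0.
have tp : 0 < t by rewrite lt_def tn0.
have tm : t < 1 by rewrite lt_neqAle tn1.
case: Hx Hy => [Kx|lx] [Ky|ly]; first by left; exact: Kseg.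
- by right; rewrite (Kl x Kx); nra.
- by right; rewrite (Kl y Ky); nra.
- by right; nra.
Qed.

Lemma closed_segments_point p : closed_segments [set p].
Proof. by move=> x y t -> -> _ _ /=; rewrite -scalerDl addrC subrK scale1r. Qed.

End Faces.

Section Vertices.
Context {R : realType} {n : nat} (P : set 'rV[R]_n).
Implicit Types (p q x y l : 'rV[R]_n).

(** A generating family of minimal size works: by Gordan's lemma on the differences from [v j],
    either some functional is minimal at [v j] only, or [v j] is a convex combination of the others
    and could be dropped. *)
Lemma polytope_vertices : is_polytope P -> exists N (v : 'I_N -> 'rV[R]_n),
  P = convex_hull (range v) /\
  forall j, exists l, forall k, k != j -> 0 < dot l (v k - v j).
Proof.
case=> A /finite_seqP[s ->] Ps.
pose gen m := exists v : 'I_m -> 'rV[R]_n, P = convex_hull (range v).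
have ex : exists m, `[< gen m >].
  exists (size s); apply/asboolP; exists (fun i => nth 0 s i); rewrite Ps; congr convex_hull.
  apply/seteqP; split=> x /=; last by case=> i _ <-; exact: mem_nth.
  move=> xs; have si : (index x s < size s)%N by rewrite index_mem.
  by exists (Ordinal si) => //=; rewrite nth_index.
case: (ex_minnP ex) => N /asboolP[v Pv] Nmin; exists N, v; split=> // j.
case: N v Pv Nmin j => [|N] v Pv Nmin j; first by case: j.
have [[l lP]|[c [c0 [i ci] e]]] := gordan (fun i => v (lift j i) - v j).
  by exists l => k; rewrite eq_sym => /unlift_some[i -> _].
suff : gen N by move/asboolP/Nmin; rewrite ltnn.
exists (fun i => v (lift j i)); rewrite Pv; apply/seteqP; split; last first.
  by apply: hull_sub => x [k _ <-]; apply: sub_hull; exists (lift j k).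
apply: hull_sub => x [k _ <-].
case: (unliftP j k) => [k' ->|->]; first by apply: sub_hull; exists k'.
have C0 : 0 < \sum_i c i.
  by rewrite (bigD1 i) //= ltr_pwDl // sumr_ge0.
have -> : v j = \sum_i (c i / \sum_i c i) *: v (lift j i).
  apply: (scalerI (lt0r_neq0 C0)); rewrite scaler_sumr.
  move: e; under eq_bigr do rewrite scalerBr.
  rewrite sumrB -scaler_suml => /eqP; rewrite subr_eq0 => /eqP <-.
  by apply: eq_bigr => k' _; rewrite scalerA mulrC divfK ?gt_eqF.
apply: hull_sum => [k'|k'|]; first by exists k'.
  by rewrite divr_ge0 // ltW.
by rewrite -mulr_suml divff ?gt_eqF.
Qed.

Variables (N : nat) (v : 'I_N -> 'rV[R]_n).
Hypothesis Pv : P = convex_hull (range v).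
Hypothesis vsep : forall j, exists l, forall k, k != j -> 0 < dot l (v k - v j).

Lemma vert_inj : injective v.
Proof.
move=> i j e; apply/eqP/negPn/negP => ij; have [l] := vsep j.
by move/(_ i ij); rewrite e subrr dot0r ltxx.
Qed.

Lemma vert_in j : P (v j).
Proof. by rewrite Pv; apply: sub_hull; exists j. Qed.

Lemma poly_min (C : set 'rV[R]_n) : closed_segments C -> (forall j, C (v j)) -> P `<=` C.
Proof. by move=> Cs Cv; rewrite Pv; apply: hull_min => // x [j _ <-]. Qed.

Lemma poly_le l (c : R) : (forall j, c <= dot l (v j)) -> forall x, P x -> c <= dot l x.
Proof.
move=> H; apply: (poly_min (C := [set x | c <= dot l x])) => // x y t /= lx ly t0 t1.
by rewrite dotDr !dotZr; nra.
Qed.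

Lemma vert_vertex j : is_vertex P (v j).
Proof.
apply/vertexP; split; first exact: vert_in.
have [l lP] := vsep j; exists l.
apply: (poly_min (C := [set x | x = v j \/ dot l (v j) < dot l x])).
  by apply: (closed_segments_face (@closed_segments_point _ _ (v j))) => x ->.
move=> k; have [->|kj] := eqVneq k j; [by left|right].
by rewrite -subr_gt0 -dotBr lP.
Qed.

(** Otherwise all generators lie in the open half-space [dot l x < b], which is convex, and so does
    [P]. *)
Lemma face_vert l (b : R) x : (forall x, P x -> dot l x <= b) -> P x ->
  dot l x = b -> exists j, dot l (v j) = b.
Proof.
move=> lb Px lx; apply: contrapT => H.
suff : dot l x < b by rewrite lx ltxx.
move: x Px {lx}; apply: poly_min => [x y t /= lx ly t0 t1|j].
  rewrite dotDr !dotZr; case: (eqVneq t 0) => [->|tn]; first by rewrite mul0r add0r subr0 mul1r.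
  have : 0 < t by rewrite lt_def tn.
  nra.
by rewrite /= lt_neqAle lb ?andbT; [apply/eqP => e; apply: H; exists j|exact: vert_in].
Qed.

Lemma edgeC p r : is_edge P p r -> is_edge P r p.
Proof. by rewrite /is_edge setUC. Qed.

Lemma edge_neq p r : is_edge P p r -> p != r.
Proof.
move=> [d1 _]; apply: contra_not_neq (_ : 0 <> 1 :> nat) => // e; rewrite e setUid in d1.
have E : convex_hull [set r] = [set r].
  apply/seteqP; split; last exact: sub_hull.
  by apply: hull_min => //; exact: closed_segments_point.
by rewrite E in d1; exact: has_dim_uniq (has_dim_point r) d1.
Qed.

(** If [r] is not a generator, then the segment without [r], together with the open side of its
    supporting hyperplane, is a convex set containing all generators; it would then contain [r]. *)
Lemma edge_vert p r : is_edge P p r -> exists j, r = v j.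
Proof.
move=> e; have pr := edge_neq e; case: e => _ [a [b [ab e]]].
have inF z : convex_hull [set p; r] z -> P z /\ dot a z = b by rewrite e.
have [Pr ar] : P r /\ dot a r = b by apply: inF; apply: sub_hull; right.
have [Pp ap] : P p /\ dot a p = b by apply: inF; apply: sub_hull; left.
apply: contrapT => H.
pose C := [set x | (exists t : R, [/\ 0 <= t, t < 1 & x = p + t *: (r - p)])].
have Cseg : closed_segments C.
  move=> x y t [s [s0 s1 ->]] [u [u0 u1 ->]] t0 t1.
  exists (t * s + (1 - t) * u); split; [nra| |].
    case: (eqVneq t 0) => [->|tn]; first by rewrite mul0r add0r subr0 mul1r.
    have : 0 < t by rewrite lt_def tn.
    nra.
  have f : t *: p + (1 - t) *: p = p by rewrite -scalerDl addrC subrK scale1r.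
  by move: (r - p) => d; rewrite !scalerDr !scalerA addrACA f -scalerDl.
have : [set x | C x \/ - b < dot (- a) x] r.
  move: (r) Pr; apply: poly_min => [|j].
    apply: closed_segments_face Cseg _ => x [t [_ _ ->]].
    by rewrite dotDr dotZr dotBr !dotNl ar ap subrr mulr0 addr0.
  have := ab _ (vert_in j); rewrite le_eqVlt => /predU1P[aj|]; last first.
    by right; rewrite dotNl ltrN2.
  have : convex_hull [set p; r] (v j) by rewrite e; split=> //; exact: vert_in.
  move=> /hull_pair[t [t0]]; rewrite le_eqVlt => /predU1P[->|t1] E; last by left; exists t.
  by case: H; exists j; rewrite E scale1r addrC subrK.
case; last by rewrite dotNl ar ltxx.
case=> t [_ t1 rE]; have /eqP : t *: (r - p) = r - p by rewrite {2}rE [p + _]addrC addrK.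
rewrite -subr_eq0 -{2}[r - p]scale1r -scalerBl scaler_eq0 !subr_eq0 => /orP[/eqP t1'|].
  by rewrite t1' ltxx in t1.
by rewrite eq_sym (negPf pr).
Qed.

Lemma edge_intro j r l : r != j ->
  (forall k, 0 <= dot l (v k - v j)) ->
  (forall k, dot l (v k - v j) = 0 ->
     exists t : R, [/\ 0 <= t, t <= 1 & v k = v j + t *: (v r - v j)]) ->
  dot l (v r - v j) = 0 -> is_edge P (v j) (v r).
Proof.
move=> rj l0 lray lr; split.
  by apply: has_dim_segment; rewrite eq_sym (inj_eq vert_inj).
exists (- l), (- dot l (v j)); split=> [x Px|].
  rewrite dotNl lerN2; apply: (poly_le _ Px) => k.
  by rewrite -subr_ge0 -dotBr.
pose K := convex_hull [set v j; v r].
have Kl x : K x -> dot l x = dot l (v j).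
  by move=> /hull_pair[t [_ _ ->]]; rewrite dotDr dotZr lr mulr0 addr0.
have PK : P `<=` [set x | K x \/ dot l (v j) < dot l x].
  apply: poly_min => [|k]; first exact: closed_segments_face (@hull_segments _ _ _) Kl.
  have := l0 k; rewrite le_eqVlt => /predU1P[e|lt].
    by left; apply/hull_pair; apply: lray.
  by right; rewrite -subr_gt0 -dotBr.
apply/seteqP; split=> x.
  move=> Kx; split; last by rewrite /= dotNl (Kl x Kx).
  by move: Kx; rewrite Pv; apply: hull_sub => y [->|->]; rewrite -Pv; exact: vert_in.
by case=> /PK[//|lt]; rewrite /= dotNl => /oppr_inj e; rewrite e ltxx in lt.
Qed.

(* A minimal subfamily of the [v i - v j] generating the same cone spans
   exposed rays of that cone, by Gordan's lemma modulo each of its members;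
   these rays are the edges at [v j]. *)
Lemma edges_span j (f : 'rV[R]_n) :
  (forall r, is_edge P (v j) (v r) -> 0 <= dot f (v r - v j)) ->
  forall x, P x -> 0 <= dot f (x - v j).
Proof.
move=> fe.
pose gen m := exists u : 'I_m -> 'I_N, forall i, exists c : 'I_m -> R,
  (forall k, 0 <= c k) /\ v i - v j = \sum_k c k *: (v (u k) - v j).
have ex : exists m, `[< gen m >].
  exists N; apply/asboolP; exists id => i; exists (fun k => (k == i)%:R); split=> [k|].
    exact: ler0n.
  by rewrite (bigD1 i) //= eqxx scale1r big1 ?addr0 // => k /negPf->; rewrite scale0r.
case: (ex_minnP ex) => m /asboolP[u uP] mmin.
suff fu k : 0 <= dot f (v (u k) - v j).
  move=> x Px; rewrite dotBr subr_ge0; apply: poly_le x Px => i.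
  rewrite -subr_ge0 -dotBr; have [c [c0 ->]] := uP i.
  by rewrite dot_sumr sumr_ge0 // => k _; rewrite dotZr mulr_ge0.
case: m u uP mmin k => [|m] u uP mmin g; first by case: g.
pose w k := v (u k) - v j.
have irred h (c : 'I_m -> R) : (forall k, 0 <= c k) ->
    w h = \sum_k c k *: w (lift h k) -> False.
  move=> c0 e; suff : gen m by move/asboolP/mmin; rewrite ltnn.
  exists (fun k => u (lift h k)) => i; have [d [d0 ->]] := uP i.
  exists (fun k => d h * c k + d (lift h k)); split=> [k|].
    by rewrite addr_ge0 ?mulr_ge0.
  rewrite (bigD1_ord h) //= -/(w h) e scaler_sumr -big_split /=.
  by apply: eq_bigr => k _; rewrite scalerDl scalerA.
have wn0 k : w k != 0.
  apply/eqP => e; apply: (irred k (fun=> 0)) => //; rewrite e big1 // => i _; exact: scale0r.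
have un k : u k != j by apply: contraNneq (wn0 k) => e; rewrite /w e subrr.
have wg0 := wn0 g.
have [l0 l0P] := vsep j.
pose w' k := w (lift g k) - (dot (w g) (w (lift g k)) / dot (w g) (w g)) *: w g.
have [[l lw]|[c [c0 [i ci] e]]] := gordan w'; last first.
  (* The relation puts [T *: w g] into the cone of the other generators. As [l0] is positive on
     every generator, [T] is positive, against minimality. *)
  exfalso; pose T := \sum_k c k * (dot (w g) (w (lift g k)) / dot (w g) (w g)).
  have eT : \sum_k c k *: w (lift g k) = T *: w g.
    apply/eqP; rewrite -subr_eq0 -[X in _ == X]e /w' /T; apply/eqP.
    under [RHS]eq_bigr => j' _ do rewrite scalerBr scalerA.
    by rewrite sumrB -scaler_suml.
  have T0 : 0 < T.
    have : 0 < dot l0 (T *: w g).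
      rewrite -eT dot_sumr (bigD1 i) //= ltr_pwDl //.
        by rewrite dotZr mulr_gt0 // l0P.
      by apply: sumr_ge0 => k _; rewrite dotZr mulr_ge0 // ltW // l0P.
    by rewrite dotZr pmulr_lgt0 // l0P.
  apply: (irred g (fun k => c k / T)) => [k|]; first by rewrite divr_ge0 // ltW.
  apply: (scalerI (lt0r_neq0 T0)); rewrite -eT scaler_sumr.
  by apply: eq_bigr => k _; rewrite scalerA mulrC divfK ?gt_eqF.
have gg := dot_gt0 wg0.
(* Removing the component along [w g] gives a functional that vanishes on [w g] and is positive on
   the other generators, so it exposes the ray of [w g]. *)
pose h := l - (dot l (w g) / dot (w g) (w g)) *: w g.
have hg : dot h (w g) = 0 by rewrite /h dotBl dotZl divfK ?gt_eqF // subrr.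
have hw k : 0 < dot h (w (lift g k)).
  have := lw k; rewrite /w' /h (dotBr l) (dotBl l) dotZr dotZl.
  by congr (_ < _); ring.
have hv k : 0 <= dot h (v k - v j) /\ (dot h (v k - v j) = 0 ->
    exists2 t : R, 0 <= t & v k - v j = t *: w g).
  have [c [c0 ->]] := uP k; rewrite (bigD1_ord g) //= -/(w g) dotDr dotZr hg mulr0 add0r.
  rewrite dot_sumr; split.
    by apply: sumr_ge0 => i _; rewrite dotZr mulr_ge0 // (ltW (hw i)).
  have hw0 i : 0 <= dot h (c (lift g i) *: w (lift g i)) by rewrite dotZr mulr_ge0 // ltW.
  move/(psumr_eq0P (fun i _ => hw0 i)) => z; exists (c g) => //; rewrite big1 ?addr0 // => i _.
  have /eqP := z i isT; rewrite dotZr mulf_eq0 (gt_eqF (hw i)) orbF => /eqP ->.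
  exact: scale0r.
(* The position of [v k] along this ray; the vertex farthest out is the other end of an edge. *)
pose T k := dot (w g) (v k - v j) / dot (w g) (w g).
have TE k : dot h (v k - v j) = 0 -> 0 <= T k /\ v k - v j = T k *: w g.
  by case: (hv k) => _ H /H[t t0 e]; rewrite /T e dotZr mulfK ?gt_eqF.
have Pg : dot h (v (u g) - v j) == 0 by rewrite -/(w g) hg.
case: (@arg_maxP _ _ _ (u g) (fun k => dot h (v k - v j) == 0) T Pg) => r /eqP hr rmax'.
have rmax k : dot h (v k - v j) = 0 -> T k <= T r by move/eqP; exact: rmax'.
have Tg : T (u g) = 1 by rewrite /T divff ?gt_eqF.
have Tr : 0 < T r by rewrite (lt_le_trans ltr01) // -Tg rmax.
have [_ rE] := TE r hr.
suff : is_edge P (v j) (v r).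
  by move/fe; rewrite rE dotZr pmulr_rge0.
apply: (@edge_intro _ _ h) => //.
- apply: contraTneq Tr => ->; by rewrite /T subrr dot0r mul0r ltxx.
- by move=> k; case: (hv k).
move=> k hk; have [Tk kE] := TE k hk; exists (T k / T r).
split; first by rewrite divr_ge0 // ltW.
  by rewrite ler_pdivrMr // mul1r rmax.
by rewrite rE scalerA divfK ?gt_eqF // -kE addrC subrK.
Qed.

End Vertices.

(** * Integer vectors and the h-vector *)

Section Generic.
Context {n : nat}.
Implicit Types (a b x : 'rV[int]_n).

Definition dotz a b : int := (a *m b^T) 0 0.

Lemma dotzDr a b x : dotz a (b + x) = dotz a b + dotz a x.
Proof. by rewrite /dotz linearD mulmxDr mxE. Qed.

Lemma dotzZr (c : int) a b : dotz a (c *: b) = c * dotz a b.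
Proof. by rewrite /dotz linearZ -scalemxAr mxE. Qed.

Lemma dotzBl a b x : dotz (a - b) x = dotz a x - dotz b x.
Proof. by rewrite /dotz mulmxBl !mxE. Qed.

Lemma dotzZl (c : int) a b : dotz (c *: a) b = c * dotz a b.
Proof. by rewrite /dotz -scalemxAl mxE. Qed.

Lemma dot_lattice_vec (R : realType) a b :
  dot (lattice_vec a) (lattice_vec b) = (dotz a b)%:~R :> R.
Proof.
rewrite /dotz mxE rmorph_sum; apply: eq_bigr => k _.
by rewrite rmorphM !mxE.
Qed.

Lemma dotz_gt0 a : a != 0 -> 0 < dotz a a.
Proof.
move=> a0; rewrite /dotz mxE lt_def sumr_ge0 ?andbT => [|i _]; last first.
  by rewrite mxE -expr2 sqr_ge0.
apply: contraNneq a0 => /psumr_eq0P e; apply/eqP/rowP => i.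
rewrite [RHS]mxE; apply/eqP; rewrite -sqrf_eq0 expr2.
have := e _ i isT; rewrite mxE => -> // j _.
by rewrite mxE -expr2 sqr_ge0.
Qed.

(** By induction: if [x] is orthogonal to the new vector [a], it becomes [M *: x + a]. This pairs
    with [a] to [dotz a a], and [M] exceeds every [dotz b a] in absolute value, so the old pairings
    stay nonzero. *)
Lemma generic_vector (s : seq 'rV[int]_n) : (forall a, a \in s -> a != 0) ->
  exists x, forall a, a \in s -> dotz a x != 0.
Proof.
elim: s => [|a s IH] s0; first by exists 0.
have [x xs] := IH (fun b bs => s0 b (mem_behead (s := a :: s) bs)).
have [ax|ax] := eqVneq (dotz a x) 0; last first.
  by exists x => b; rewrite inE => /predU1P[->|/xs].
have a0 : a != 0 by apply: s0; rewrite mem_head.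
pose M : int := 1 + \sum_(b <- s) `|dotz b a|.
exists (M *: x + a) => b; rewrite inE dotzDr dotzZr => /predU1P[->|bs].
  by rewrite ax mulr0 add0r gt_eqF // dotz_gt0.
have bM : `|dotz b a| < M.
  rewrite /M (big_rem b bs) /= addrCA ltrDl ltr_pwDl // sumr_ge0 //.
have M0 : 0 < M by rewrite (le_lt_trans _ bM).
apply/eqP => e; have : M <= `|M * dotz b x|.
  by rewrite normrM gtr0_norm // ler_peMr ?(ltW M0) // -gtz0_ge1 normr_gt0 xs.
by move/eqP: e; rewrite addr_eq0 => /eqP ->; rewrite normrN leNgt bM.
Qed.

End Generic.

Lemma bin2R (F : numFieldType) k : 'C(k, 2)%:R = k%:R * (k%:R - 1) / 2 :> F.
Proof.
elim: k => [|k IH]; first by rewrite mul0r mul0r.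
by rewrite binS bin1 natrD IH -addn1 natrD; field.
Qed.

Section HVector.
Context {R : realType} {n : nat} (P : set 'rV[R]_n) (h : 'I_n.+1 -> nat).
Hypothesis Ph : has_h_vector P h.

(** Composing the defining identity with ['X + 1] turns [('X - 1) ^+ i] into ['X^i]; compare the
    coefficients of degree [d]. *)
Lemma face_count_h d : (d <= n)%N ->
  (face_count P d)%:R = \sum_j (h j)%:R * 'C(j, d)%:R :> rat.
Proof.
move=> dn; have dn' : (d < n.+1)%N by [].
have := congr1 (fun p : {poly int} => (p \Po ('X + 1))`_d) Ph => /=.
rewrite !(linear_sum, rmorph_sum) !coef_sum.
have coefE (i : 'I_n.+1) : ((h i)%:R *: 'X^i \Po ('X + 1) : {poly int})`_d
   = (h i * 'C(i, d))%:R.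
  rewrite comp_polyZ coefZ comp_Xn_poly exprD1n coef_sum natrM; congr (_ * _).
  under eq_bigr do rewrite coefMn coefXn.
  have [di|id] := ltnP d i.+1; last first.
    rewrite bin_small // big1 // => k _.
    by rewrite gtn_eqF ?mul0rn // (leq_trans (ltn_ord k)).
  rewrite (bigD1 (Ordinal di)) //= eqxx big1 ?addr0 // => k /eqP kd.
  by case: eqP => [e|]; rewrite ?mul0rn //; case: kd; apply: val_inj.
have coefE' (i : 'I_n.+1) :
   ((face_count P i)%:R *: ('X - 1) ^+ i \Po ('X + 1) : {poly int})`_d
   = if i == Ordinal dn' then (face_count P i)%:R else 0.
  have XE : ('X - 1 : {poly int}) \Po ('X + 1) = 'X.
    by rewrite comp_polyB comp_polyX -polyC1 comp_polyC polyC1 addrK.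
  rewrite comp_polyZ coefZ rmorphXn /= XE coefXn -val_eqE /= eq_sym.
  by case: eqP; rewrite ?mulr1 ?mulr0.
rewrite (eq_bigr _ (fun i _ => coefE i)) (eq_bigr _ (fun i _ => coefE' i)) -big_mkcond.
rewrite big_pred1_eq /= => e.
have := congr1 (fun z : int => z%:~R : rat) e; rewrite /= rmorph_sum /=.
rewrite [RHS]rmorph_nat => <-; apply: eq_bigr => j _.
by rewrite natrM rmorphM !rmorph_nat.
Qed.

(** Here 6j(j-1) is 12 times the binomial coefficient of j over 2, and the sum of the h_j is the
    number of vertices. *)
Lemma chern_boundE : (1 < n)%N -> chern_bound h =
  12 * (face_count P 2)%:R + (5 * n%:R - 3 * n%:R ^+ 2) / 2 * (face_count P 0)%:R.
Proof.
move=> n1; rewrite !face_count_h // /chern_bound !mulr_sumr -big_split /=.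
by apply: eq_bigr => j _; rewrite bin0 bin2R; field.
Qed.

End HVector.

(** * Smooth and reflexive polytopes *)

Section Primitive.
Context {n : nat}.
Implicit Types (a b : 'rV[int]_n).

Lemma primitiveN a : is_primitive a -> is_primitive (- a).
Proof. by rewrite /is_primitive; under [X in _ -> X = _]eq_bigr do rewrite mxE abszN. Qed.

Lemma biggcdn_mull (m : nat) (F : 'I_n -> nat) :
  \big[gcdn/0%N]_i (m * F i)%N = (m * \big[gcdn/0%N]_i F i)%N.
Proof. by rewrite (big_morph _ (muln_gcdr m) (muln0 m)). Qed.

(** Proportionality gives |b_i| |a_k| = |a_i| |b_k|; taking the gcd over k yields |b_i| = |a_i|, and
    a nonzero b_i forces t = 1. *)
Lemma primitive_proportional (R : realType) a b (t : R) :
  is_primitive a -> is_primitive b -> 0 < t ->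
  lattice_vec a = t *: lattice_vec b -> a = b.
Proof.
move=> pa pb t0 /rowP e.
have ak k : (a 0 k)%:~R = t * (b 0 k)%:~R by have := e k; rewrite !mxE.
have [i bi] : exists i, b 0 i != 0.
  apply: contrapT => H; move: pb; rewrite /is_primitive big1 // => k _.
  apply/eqP; rewrite absz_eq0; apply/negPn/negP => bk; apply: H; by exists k.
have cross k : (`|b 0%R i| * `|a 0%R k|)%N = (`|a 0%R i| * `|b 0%R k|)%N.
  rewrite -!abszM; congr absz; apply/eqP; rewrite -(eqr_int R) !rmorphM /= !ak; apply/eqP; ring.
have ba : absz (b 0 i) = absz (a 0 i).
  have := biggcdn_mull (absz (b 0 i)) (fun k => absz (a 0 k)).
  by rewrite pa muln1 (eq_bigr _ (fun k _ => cross k)) biggcdn_mull pb muln1.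
suff t1 : t = 1 by apply/rowP => k; apply/eqP; rewrite -(eqr_int R) ak t1 mul1r.
have b0 : `|(b 0 i)%:~R| != 0 :> R by rewrite normr_eq0 intr_eq0.
apply: (mulIf b0); rewrite mul1r -{1}[t]gtr0_norm // -normrM -ak.
by rewrite -!intr_norm -!natr_absz ba.
Qed.

End Primitive.

Section Unimodular.
Context {n : nat}.

Lemma rows_Zbasis_inv (B : 'M[int]_n) : rows_Zbasis B ->
  exists2 D : 'M[int]_n, B *m D = 1%:M & D *m B = 1%:M.
Proof.
move=> HB; suff [D DB] : exists D : 'M[int]_n, D *m B = 1%:M.
  by exists D => //; exact: mulmx1C.
have /choice[c cP] i : exists c : 'rV[int]_n, row i 1%:M = c *m B.
  by have [c [e _]] := HB (row i 1%:M); exists c; rewrite mulmx_sum_row.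
by exists (\matrix_i c i); apply/row_matrixP => i; rewrite row_mul rowK -cP.
Qed.

End Unimodular.

(** * Edge bases at the vertices and the edge connection *)

Section Smooth.
Context {R : realType} {n : nat} (P : set 'rV[R]_n).
Variables (N : nat) (v : 'I_N -> 'rV[R]_n).
Hypothesis Pv : P = convex_hull (range v).
Hypothesis vsep : forall j, exists l, forall k, k != j -> 0 < dot l (v k - v j).
Variables (nb : 'I_N -> 'I_n -> 'I_N) (B D : 'I_N -> 'M[int]_n) (ln : 'I_N -> 'I_n -> R).
Hypothesis nbP : forall j r, is_edge P (v j) (v r) <-> exists i, r = nb j i.
Hypothesis BD : forall j, B j *m D j = 1%:M.
Hypothesis DB : forall j, D j *m B j = 1%:M.
Hypothesis prim : forall j i, is_primitive (row i (B j)).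
Hypothesis ln_gt0 : forall j i, 0 < ln j i.
Hypothesis edgeE : forall j i, v (nb j i) - v j = ln j i *: lattice_vec (row i (B j)).

Local Notation al j i := (row i (B j)).
Local Notation lv := (@lattice_vec R n).

(* As [D j] is inverse to [B j], these are coordinates in the basis of edge
   vectors at [v j]. *)
Definition co (j : 'I_N) (x : 'rV[R]_n) (k : 'I_n) : R := (x *m map_mx intr (D j)) 0 k.
Definition coz (j : 'I_N) (a : 'rV[int]_n) (k : 'I_n) : int := (a *m D j) 0 k.

Lemma coD j x y k : co j (x + y) k = co j x k + co j y k.
Proof. by rewrite /co mulmxDl mxE. Qed.

Lemma coZ j t x k : co j (t *: x) k = t * co j x k.
Proof. by rewrite /co -scalemxAl mxE. Qed.

Lemma coB j x y k : co j (x - y) k = co j x k - co j y k.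
Proof. by rewrite coD -scaleN1r coZ mulN1r. Qed.

Lemma co_lv j a k : co j (lv a) k = (coz j a k)%:~R.
Proof. by rewrite /co /coz /lattice_vec -map_mxM mxE. Qed.

Lemma cozB j a b k : coz j (a - b) k = coz j a k - coz j b k.
Proof. by rewrite /coz mulmxBl !mxE. Qed.

Lemma cozZ j c a k : coz j (c *: a) k = c * coz j a k.
Proof. by rewrite /coz -scalemxAl mxE. Qed.

Lemma coz_al j i k : coz j (al j i) k = (i == k)%:R.
Proof. by rewrite /coz -row_mul BD !mxE. Qed.

Lemma co_al j i k : co j (lv (al j i)) k = (i == k)%:R.
Proof. by rewrite co_lv coz_al; case: eqP. Qed.

Lemma co_dot j x k : co j x k = dot (lv (col k (D j))^T) x.
Proof. by rewrite dotC dotE /co !mxE; apply: eq_bigr => i _; rewrite !mxE. Qed.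

Lemma coK j x : x = \sum_k co j x k *: lv (al j k).
Proof.
have e : x = x *m map_mx intr (D j) *m map_mx intr (B j).
  by rewrite -mulmxA -map_mxM DB map_mx1 mulmx1.
rewrite {1}e mulmx_sum_row; apply: eq_bigr => k _; congr (_ *: _).
by rewrite /lattice_vec map_row.
Qed.

Lemma cozK j a : a = \sum_k coz j a k *: al j k.
Proof. by rewrite -mulmx_sum_row -mulmxA DB mulmx1. Qed.

Lemma co_inj j x y : (forall k, co j x k = co j y k) -> x = y.
Proof. by move=> e; rewrite (coK j x) (coK j y); apply: eq_bigr => k _; rewrite e. Qed.

(** The coordinate is the functional given by a column of [D j]; it is non-negative on the edges at
    [v j], hence on [P] by [edges_span]. *)
Lemma cone_co j x k : P x -> 0 <= co j (x - v j) k.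
Proof.
move=> Px; rewrite co_dot; apply: (edges_span Pv vsep) x Px => r /nbP[i ->].
by rewrite -co_dot edgeE coZ co_al mulr_ge0 // ?ler0n // ltW.
Qed.

Lemma al_neq0 j i : al j i != 0.
Proof.
apply/eqP => e; have := coz_al j i i; rewrite e eqxx /coz mul0mx mxE => /eqP.
by rewrite eq_sym oner_eq0.
Qed.

(** Makes [nabla] unique: basis vectors congruent modulo a basis vector coincide. *)
Lemma row_uniq j i k m (d : int) : al j m - al j k = d *: al j i -> m = k.
Proof.
move=> e; apply/eqP/negPn/negP => mk.
have E l : (m == l)%:R - (k == l)%:R = d * (i == l)%:R :> int.
  by rewrite -!(coz_al j) -cozB e cozZ.
have [ik|/negPf ik] := eqVneq i k.
  by have := E m; rewrite ik eqxx eq_sym (negPf mk) mulr0.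
by have := E k; rewrite ik eqxx (negPf mk) mulr0.
Qed.

Lemma rev_edge j i : exists i', nb (nb j i) i' = j /\ al (nb j i) i' = - al j i.
Proof.
have [i' e] : exists i', j = nb (nb j i) i'.
  by apply/nbP/edgeC/nbP; exists i.
exists i'; split=> //.
have lq := ln_gt0 (nb j i) i'; have lj := ln_gt0 j i.
apply: (@primitive_proportional _ R _ _ (ln j i / ln (nb j i) i')).
- exact: prim.
- exact/primitiveN/prim.
- exact: divr_gt0.
apply: (scalerI (lt0r_neq0 lq)); rewrite -edgeE -e -opprB edgeE.
rewrite scalerA mulrC divfK ?gt_eqF // /lattice_vec map_mxN scalerN.
by [].
Qed.

(** Seen from [v j] or from [v (nb j i)], the vertex [v (nb j k)] has positions differing by a
    multiple of [al (nb j i) i'], which does not affect the coordinate [m]; then [cone_co]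
    applies. *)
Lemma coz_ge0 j i i' k m : al (nb j i) i' = - al j i -> m != i' ->
  0 <= coz (nb j i) (al j k) m.
Proof.
move=> e mi'; rewrite -(ler_int R) -co_lv -(pmulr_rge0 _ (ln_gt0 j k)) -coZ -edgeE.
have -> : v (nb j k) - v j = (v (nb j k) - v (nb j i)) - ln j i *: lv (al (nb j i) i').
  by rewrite e /lattice_vec map_mxN scalerN opprK -edgeE addrA subrK.
rewrite coB coZ co_al eq_sym (negPf mi') mulr0 subr0.
by apply: cone_co; exact: (vert_in Pv).
Qed.

(* Modulo the direction of the edge, the edge vectors at its two ends generate
   the same cone, so the transition matrices [M] and [W] between them are
   nonnegative and inverse to each other, hence permutation matrices. *)
Lemma next_edge j i k : exists k' (c : int),
  al (nb j i) k' = al j k - c *: al j i.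
Proof.
have [i' [e ei]] := rev_edge j i; set q := nb j i in e ei *.
have [->|ki] := eqVneq k i.
  by exists i', 2; rewrite ei scaler_nat mulr2n opprD addrA subrr sub0r.
have ei' : al (nb q i') i = - al q i' by rewrite e ei opprK.
pose M m := coz q (al j k) m; pose W m l := coz j (al q m) l.
have M0 m : m != i' -> 0 <= M m by move=> mi; exact: coz_ge0 ei mi.
have W0 m l : l != i -> 0 <= W m l.
  by move=> li; have := coz_ge0 m ei' li; rewrite e.
have Wi l : l != i -> W i' l = 0.
  by move=> li; rewrite /W ei /coz mulNmx mxE -/(coz j _ _) coz_al eq_sym (negPf li) oppr0.
have MW l : \sum_m M m * W m l = (k == l)%:R.
  rewrite -(coz_al j) (cozK q (al j k)) /coz mulmx_suml summxE.
  by apply: eq_bigr => m _; rewrite -scalemxAl mxE.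
have MW0 m l : l != i -> 0 <= M m * W m l.
  move=> li; have [->|mi] := eqVneq m i'; first by rewrite Wi // mulr0.
  by rewrite mulr_ge0 ?M0 ?W0.
(* As [MW k] equals 1, some term is nonzero. Its factors are positive integers with product at most
   1, so [W m k = 1]; the sums for [l] other than [i] and [k] vanish, so [W m l = 0]. Only the
   coefficient at [al j i] stays free, and it is [- c]. *)
have [m MWm] : exists m, M m * W m k != 0.
  apply: contrapT => H; have := MW k; rewrite eqxx big1 // => m _.
  by apply/eqP/negPn/negP => ?; apply: H; exists m.
have mi : m != i' by apply: contraNneq MWm => ->; rewrite Wi // mulr0.
have Mm : 0 < M m.
  by rewrite lt_def M0 // andbT; apply: contraNneq MWm => ->; rewrite mul0r.
exists m, (- W m i); rewrite scaleNr opprK (cozK j (al q m)).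
rewrite (bigD1 k) //= (bigD1 i) 1?eq_sym //= big1 ?addr0 => [|l /andP[lk li]].
  congr (_ + _); rewrite -[RHS]scale1r; congr (_ *: _).
  have Wm : 0 < W m k.
    by rewrite lt_def W0 // andbT; apply: contraNneq MWm => w; rewrite w mulr0.
  have : M m * W m k <= 1.
    rewrite -[1]/((true : nat)%:R) -[true](eqxx k) -MW (bigD1 m) //= lerDl sumr_ge0 // => l _.
    exact: MW0.
  by rewrite -/(W m k); nia.
have /eqP := MW l; rewrite [k == l]eq_sym (negPf lk) psumr_eq0.
  2: by move=> m' _; exact: MW0.
move=> /allP/(_ m).
rewrite mem_index_enum /= mulf_eq0 (gt_eqF Mm) => /(_ isT)/eqP.
by rewrite /W => ->; rewrite scale0r.
Qed.

(** The last clause recognizes a relation as in [is_line_chern] as a value of [nx] and [ch]. *)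
Lemma connection_exists :
  exists (nx : 'I_N -> 'I_n -> 'I_n -> 'I_n) (ch : 'I_N -> 'I_n -> 'I_n -> int),
  [/\ forall j i k, al (nb j i) (nx j i k) = al j k - ch j i k *: al j i,
      forall j i, nb (nb j i) (nx j i i) = j,
      forall j i k, nx (nb j i) (nx j i i) (nx j i k) = k,
      forall j i, ch j i i = 2
    & forall j i m k c, al (nb j i) m = al j k - c *: al j i -> m = nx j i k /\ c = ch j i k].
Proof.
have /choice[nc ncP] (t : 'I_N * 'I_n * 'I_n) : exists kc : 'I_n * int,
    al (nb t.1.1 t.1.2) kc.1 = al t.1.1 t.2 - kc.2 *: al t.1.1 t.1.2.
  by have [k [c e]] := next_edge t.1.1 t.1.2 t.2; exists (k, c).
pose nx j i k := (nc (j, i, k)).1; pose ch j i k := (nc (j, i, k)).2.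
have T j i k : al (nb j i) (nx j i k) = al j k - ch j i k *: al j i by exact: ncP (j, i, k).
have U j i m k c : al (nb j i) m = al j k - c *: al j i -> m = nx j i k /\ c = ch j i k.
  move=> e; have [i' [_ ei]] := rev_edge j i.
  have mE : m = nx j i k.
    apply: (@row_uniq (nb j i) i' _ _ (c - ch j i k)).
    by rewrite e T ei opprB addrC addrA subrK scalerN scalerBl opprB addrC.
  split=> //; have : al j k - c *: al j i = al j k - ch j i k *: al j i by rewrite -e -T mE.
  move/addrI/oppr_inj/(congr1 (fun a => coz j a i)).
  by rewrite !cozZ coz_al eqxx !mulr1.
exists nx, ch.
have rv j i : nb (nb j i) (nx j i i) = j /\ ch j i i = 2.
  have [i' [e ei]] := rev_edge j i.
  have [] := U j i i' i 2; first by rewrite ei scaler_nat mulr2n opprD addrA subrr sub0r.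
  by move=> <- <-.
split=> //; [by move=> j i; case: (rv j i)| |by move=> j i; case: (rv j i)].
move=> j i k; have [e e2] := rv j i.
have := T (nb j i) (nx j i i) (nx j i k); rewrite e.
set c := ch _ _ _ => E.
(* Transport forth and back changes [al j k] only by a multiple of [al j i]. *)
apply: (@row_uniq j i _ _ (c - ch j i k)).
rewrite E T (T j i i) e2 scaler_nat mulr2n opprD addrA subrr sub0r scalerN opprK.
by rewrite scalerBl addrC addrA addKr addrC.
Qed.

Lemma ln_rev j i i' : nb (nb j i) i' = j -> al (nb j i) i' = - al j i ->
  ln (nb j i) i' = ln j i.
Proof.
move=> e ei; have := edgeE (nb j i) i'; rewrite e ei -opprB edgeE.
have -> : lv (- al j i) = - lv (al j i) by rewrite /lattice_vec map_mxN.
rewrite scalerN => /oppr_inj/(congr1 (fun x => co j x i)).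
by rewrite /= !coZ co_al eqxx !mulr1.
Qed.

Lemma primitive_along_al j i a : primitive_along (v j) (v (nb j i)) a -> a = al j i.
Proof.
case=> pa [t t0]; rewrite edgeE => e.
apply: (@primitive_proportional _ R _ _ (ln j i / t)) => //; first exact: divr_gt0.
by apply: (scalerI (lt0r_neq0 t0)); rewrite -e scalerA mulrC divfK ?gt_eqF.
Qed.

(** * Counting faces by their highest vertices *)

Section FaceCount.
Implicit Types I : {set 'I_n}.
Variable f : 'rV[R]_n.
Hypothesis f_neq0 : forall j i, dot f (lv (al j i)) != 0.

Definition desc j : {set 'I_n} := [set i | dot f (lv (al j i)) < 0].

(* The face spanned at the vertex [v t.1] by the edges with indices in [t.2]. *)
Definition corner (t : 'I_N * {set 'I_n}) : set 'rV[R]_n :=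
  P `&` [set x | forall k, k \notin t.2 -> co t.1 (x - v t.1) k = 0].

Lemma corner_top j I : corner (j, I) (v j).
Proof.
split; first exact: (vert_in Pv).
by move=> k _; rewrite subrr /co mul0mx mxE.
Qed.

Lemma corner_nb j I k : corner (j, I) (v (nb j k)) <-> k \in I.
Proof.
split=> [[_ H]|kI].
  apply: contraT => /H; rewrite /= edgeE coZ co_al eqxx mulr1 => e.
  by have := ln_gt0 j k; rewrite e ltxx.
split; first exact: (vert_in Pv).
move=> l /= lI; rewrite edgeE coZ co_al; case: eqVneq lI => [<-|_ _]; first by rewrite kI.
by rewrite mulr0.
Qed.

Lemma free_al j (I : {set 'I_n}) : free [seq lv (al j k) | k <- enum I].
Proof.
have fr : free [seq lv (al j k) | k <- enum 'I_n].
  rewrite /free size_map size_enum_ord eqn_leq.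
  have -> : <<[seq lv (al j k) | k <- enum 'I_n]>>%VS = fullv.
    apply/eqP; rewrite eqEsubv subvf /=; apply/subvP => x _.
    rewrite (coK j x) memv_suml // => k _; rewrite memvZ // memv_span //.
    by apply/mapP; exists k => //; rewrite mem_enum.
  by rewrite dimvf /dim /= mul1n leqnn.
have pm : perm_eq [seq lv (al j k) | k <- enum 'I_n]
    ([seq lv (al j k) | k <- enum I] ++ [seq lv (al j k) | k <- enum (~: I)]).
  rewrite -map_cat perm_map // uniq_perm ?enum_uniq ?cat_uniq ?enum_uniq ?andbT //=.
    by apply/hasPn => k; rewrite !mem_enum inE.
  by move=> k; rewrite mem_cat !mem_enum finset.in_setC orbN.
by move: fr; rewrite (perm_free pm) => /catl_free.
Qed.

Lemma corner_dim j I : has_dim (corner (j, I)) #|I|.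
Proof.
exists (v j), <<[seq lv (al j k) | k <- enum I]>>%VS; split.
- exact: corner_top.
- by have := free_al j I; rewrite /free size_map -cardE => /eqP.
move=> W; split=> [UW x [Px Hx]|H].
  rewrite (coK j (x - v j)) memv_suml // => k _.
  have [kI|kI] := boolP (k \in I); last by rewrite Hx // scale0r mem0v.
  rewrite memvZ // (subvP UW) // memv_span //.
  by apply/mapP; exists k => //; rewrite mem_enum.
apply/span_subvP => x /mapP[k]; rewrite mem_enum => kI ->.
have := H _ ((corner_nb j I k).2 kI); rewrite edgeE => /(memvZ (ln j k)^-1).
by rewrite scalerA mulVf ?scale1r // gt_eqF.
Qed.

Lemma corner_face j I : is_face P #|I| (corner (j, I)).
Proof.
split; first exact: corner_dim.
(* Minus the sum of the coordinates outside [I]: these are non-negative on [P] relative to [v j], so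
   the maximum is attained exactly where all of them vanish. *)
pose a : 'rV[R]_n := - \sum_(k | k \notin I) lv (col k (D j))^T.
have aE x : dot a x = - \sum_(k | k \notin I) co j x k.
  by rewrite dotNl dot_suml; congr (- _); apply: eq_bigr => k _; rewrite co_dot.
have aB x : dot a x = dot a (v j) - \sum_(k | k \notin I) co j (x - v j) k.
  by rewrite -[x in LHS](subrK (v j)) dotDr addrC; congr (_ + _); exact: aE.
exists a, (dot a (v j)); split=> [x Px|].
  by rewrite aB gerDl oppr_le0 sumr_ge0 // => k _; exact: cone_co.
apply/seteqP; split=> x [Px Hx]; split=> //=.
  by rewrite aB big1 ?subr0 // => k kI; exact: Hx.
move=> k kI; move: Hx; rewrite /= aB => /eqP; rewrite -subr_eq0 addrAC subrr sub0r oppr_eq0.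
rewrite psumr_eq0 => [/allP/(_ k (mem_index_enum _))/implyP/(_ kI)/eqP //|l _].
exact: cone_co.
Qed.

(** Points of the corner are [v j] plus non-negative combinations of descending edge vectors, so
    [v j] is the only highest point. *)
Lemma corner_le j I x : I \subset desc j -> corner (j, I) x ->
  dot f x <= dot f (v j) ?= iff (x == v j).
Proof.
move=> Id [Px Hx].
have e : dot f x = dot f (v j) + \sum_k co j (x - v j) k * dot f (lv (al j k)).
  rewrite -{1}(subrK (v j) x) dotDr addrC {1}(coK j (x - v j)) dot_sumr.
  by congr (_ + _); apply: eq_bigr => k _; rewrite dotZr.
have neg k : 0 <= - (co j (x - v j) k * dot f (lv (al j k))).
  have [/(fintype.subsetP Id)|kI] := boolP (k \in I); last by rewrite Hx // mul0r oppr0.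
  by rewrite inE -mulrN => fk; rewrite mulr_ge0 ?oppr_ge0 ?(ltW fk) //; exact: cone_co.
apply/leifP; case: eqVneq => [-> //|xv].
rewrite e gtrDl -oppr_gt0 -sumrN lt_def sumr_ge0 // andbT.
apply: contraNneq xv => /psumr_eq0P z; apply/eqP.
rewrite -[RHS]add0r -[LHS](subrK (v j)); congr (_ + _); apply: (@co_inj j) => k.
rewrite [RHS]/co mul0mx mxE; have /eqP := z (fun k _ => neg k) k isT.
by rewrite oppr_eq0 mulf_eq0 (negPf (f_neq0 _ _)) orbF => /eqP.
Qed.

(** The vertex is recovered as the highest point of the corner, the index set from the neighbours in
    it. *)
Lemma corner_inj : {in [pred t : 'I_N * {set 'I_n} | t.2 \subset desc t.1] &, injective corner}.
Proof.
move=> [j I] [j' I']; rewrite !inE /= => Id Id' e.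
have jj : j = j'.
  have c1 : corner (j, I) (v j') by rewrite e; exact: corner_top.
  have c2 : corner (j', I') (v j) by rewrite -e; exact: corner_top.
  have [l1] := corner_le Id c1; have [l2 _] := corner_le Id' c2.
  have -> : (dot f (v j') == dot f (v j)) by rewrite eq_le l1 l2.
  by move/esym/eqP/(vert_inj vsep) => ->.
subst j'; congr pair; apply/setP => k.
by apply/idP/idP => H; apply/(corner_nb j); [rewrite -e|rewrite e]; apply/corner_nb.
Qed.

(** Take the highest vertex of the face and the edges there on which the supporting functional [a]
    is constant; these descend by maximality. *)
Lemma face_corner d F : is_face P d F ->
  exists t : 'I_N * {set 'I_n}, [/\ t.2 \subset desc t.1, #|t.2| = d & F = corner t].
Proof.
move=> [dF [a [b [ab FE]]]].
have [x [_ [Fx _ _]]] := dF.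
have [Px ax] : (P `&` [set x | dot a x = b]) x by rewrite -FE.
have [j0 aj0] := face_vert Pv ab Px ax.
case: (@arg_maxP _ _ _ j0 (fun j => dot a (v j) == b) (fun j => dot f (v j))).
  exact/eqP.
move=> j /eqP aj jmax'.
have jmax k : dot a (v k) = b -> dot f (v k) <= dot f (v j) by move/eqP; exact: jmax'.
pose I := [set k | dot a (lv (al j k)) == 0]%SET.
have al_le k : dot a (lv (al j k)) <= 0.
  rewrite -(pmulr_rle0 _ (ln_gt0 j k)) -dotZr -edgeE dotBr aj subr_le0.
  by apply: ab; exact: (vert_in Pv).
have Id : I \subset desc j.
  apply/fintype.subsetP => k; rewrite !inE => /eqP ak.
  rewrite lt_neqAle f_neq0 -(pmulr_rle0 _ (ln_gt0 j k)) -dotZr -edgeE dotBr subr_le0 /=.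
  by apply: jmax; rewrite -[v _](subrK (v j)) edgeE dotDr dotZr ak mulr0 add0r.
have FI : F = corner (j, I).
  have aE z : b - dot a z = \sum_k co j (z - v j) k * - dot a (lv (al j k)).
    rewrite -aj -opprB -dotBr {1}(coK j (z - v j)) dot_sumr -sumrN.
    by apply: eq_bigr => k _; rewrite dotZr mulrN.
  rewrite FE; apply/seteqP; split=> z [Pz Hz]; split=> //=.
    move=> k kI; have /eqP := aE z; rewrite Hz subrr eq_sym psumr_eq0 => [|l _]; last first.
      by rewrite mulr_ge0 ?oppr_ge0 //; exact: cone_co.
    move/allP/(_ k (mem_index_enum _)) => /=; rewrite mulf_eq0 oppr_eq0.
    by rewrite inE in kI; rewrite (negPf kI) orbF => /eqP.
  apply/eqP; rewrite eq_sym -subr_eq0 aE big1 // => k _.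
  have [|/Hz ->] := boolP (k \in I); last by rewrite mul0r.
  by rewrite inE => /eqP->; rewrite oppr0 mulr0.
exists (j, I); split=> //=.
by apply: has_dim_uniq (corner_dim j I) _; rewrite -FI.
Qed.

Lemma face_count_desc d : face_count P d = (\sum_j 'C(#|desc j|, d))%N.
Proof.
pose X := [pred t : 'I_N * {set 'I_n} | t.2 \subset desc t.1 & #|t.2| == d].
have E : [set F | is_face P d F] = [set` [seq corner t | t <- enum X]].
  apply/seteqP; split=> F /=.
    move/face_corner => [t [tI td ->]]; apply: map_f.
    by rewrite mem_enum inE tI td eqxx.
  case/mapP => -[j I]; rewrite mem_enum inE => /andP[_ /eqP <-] ->.
  exact: corner_face.
rewrite /face_count E.
have -> : fset_set [set` [seq corner t | t <- enum X]]
    = [fset F in [seq corner t | t <- enum X]]%fset.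
  apply/fsetP => F; rewrite in_fset_set; last by apply/finite_seqP; eexists.
  by rewrite in_fset; apply/idP/idP => [/set_mem|? ]; last exact/mem_set.
rewrite card_fseq undup_id; last first.
  rewrite map_inj_in_uniq ?enum_uniq // => t t'; rewrite !mem_enum !inE.
  by move=> /andP[t1 _] /andP[t2 _]; apply: corner_inj.
rewrite size_map -cardE -sum1_card.
rewrite -(pair_big_dep xpredT
  (fun j I => (I \subset desc j) && (#|I| == d)) (fun _ _ => 1%N)) /=.
apply: eq_bigr => j _; rewrite -cards_draws -sum1_card.
by apply: eq_bigl => I; rewrite finset.inE.
Qed.

End FaceCount.

(** * Consequences of reflexivity *)

Hypothesis refl : is_reflexive P.

(** As 0 is interior, a small positive multiple of [- lv (al j i)] lies in [P], hence in the cone at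
    [v j]. *)
Lemma vert_co_lt0 j i : co j (v j) i < 0.
Proof.
have [_ P0 _] := refl.
have cz : (fun t : R => t *: - lv (al j i)) @ (0 : R) --> (0 : 'rV[R]_n).
  rewrite -[X in _ --> X](scale0r (- lv (al j i))).
  exact: (@continuousZl _ _ _ (fun t : R => t) _ _ (@cvg_id _ _)).
have : \forall t \near (0 : R), P (t *: - lv (al j i)) by exact: cz P0.
move=> /nbhs_ballP[e /= e0 /(_ (e / 2))]; rewrite /ball /= sub0r normrN gtr0_norm ?divr_gt0 //.
have e2 : e / 2 < e by lra.
move=> /(_ e2) /(cone_co j i).
rewrite coB scalerN -scaleNr coZ co_al eqxx mulr1; lra.
Qed.

(* Rescaled by its value at [v j], the [i]-th coordinate functional is a vertex
   of the dual polytope, so it is integral although its value on the [i]-th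
   edge vector is the inverse of that scale. *)
Lemma vert_coN1 j i : co j (v j) i = -1.
Proof.
have [[_ Plat] _ [_ Dlat]] := refl.
set c := - co j (v j) i; have c0 : 0 < c by rewrite oppr_gt0 vert_co_lt0.
pose y := c^-1 *: lv (col i (D j))^T : 'rV[R]_n.
have yx x : dot y x = c^-1 * co j x i by rewrite dotZl co_dot.
have yv : dot y (v j) = -1.
  by rewrite yx -[co _ _ _]opprK -/c mulrN mulVf ?gt_eqF.
have ynb k : k != i -> dot y (v (nb j k)) = -1.
  move=> ki; rewrite -[v (nb j k)](subrK (v j)) dotDr yv edgeE yx coZ co_al (negPf ki).
  by rewrite !mulr0 add0r.
have ydual : dual_polytope P y.
  move=> x Px; rewrite -yv -subr_ge0 -dotBr yx mulr_ge0 ?invr_ge0 ?(ltW c0) //.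
  exact: cone_co.
have yvert : is_vertex (dual_polytope P) y.
  apply/vertexP; split=> //.
  (* The sum of n linearly independent vertices on the facet dual to [y]. A dual point pairs with
     each of them to at least -1, and only [y] attains -1 on all. *)
  exists (v j + \sum_(k | k != i) v (nb j k)) => z zP.
  pose g (k : 'I_n) := if k == i then v j else v (nb j k).
  have gE w : dot (v j + \sum_(k | k != i) v (nb j k)) w = \sum_k dot w (g k).
    rewrite dotDl dot_suml [RHS](bigD1 i) //= /g eqxx dotC; congr (_ + _).
    by apply: eq_bigr => k /negPf->; rewrite dotC.
  have yg k : dot y (g k) = -1 by rewrite /g; case: eqVneq => // /ynb.
  have zg k : - 1 <= dot z (g k).
    by apply: zP; rewrite /g; case: ifP => _; exact: (vert_in Pv).
  rewrite !gE; set sy := \sum_k _; set sz := \sum_k _.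
  have : sy <= sz by apply: ler_sum => k _; rewrite yg.
  rewrite le_eqVlt => /predU1P[e|]; [left|by right].
  have zgE k : dot z (g k) = -1.
    have /psumr_eq0P H : \sum_k (dot z (g k) - dot y (g k)) = 0.
      by rewrite sumrB -/sy -/sz e subrr.
    apply/eqP; rewrite -subr_eq0 -(yg k) H // => m _; by rewrite yg subr_ge0.
  pose d := z - y.
  have dv : dot d (v j) = 0 by have := zgE i; rewrite /g eqxx dotBl yv => ->; rewrite subrr.
  have dal k : k != i -> dot d (lv (al j k)) = 0.
    move=> ki; apply: (mulfI (lt0r_neq0 (ln_gt0 j k))); rewrite mulr0 -dotZr -edgeE dotBr dv subr0.
    by have := zgE k; rewrite /g (negPf ki) dotBl ynb // => ->; rewrite subrr.
  have dali : dot d (lv (al j i)) = 0.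
    have := dv; rewrite {1}(coK j (v j)) dot_sumr (bigD1 i) //= big1 ?addr0 => [|k ki].
      by rewrite dotZr => /eqP; rewrite mulf_eq0 lt_eqF ?vert_co_lt0 //= => /eqP.
    by rewrite dotZr dal // mulr0.
  apply/eqP; rewrite -subr_eq0 -/d; apply: contraTT isT => /dot_gt0.
  rewrite {2}(coK j d) dot_sumr big1 ?ltxx // => k _; rewrite dotZr.
  have [->|ki] := eqVneq k i; last by rewrite dal // mulr0.
  by rewrite dali mulr0.
have [z yz] := Dlat _ yvert; have [w vw] := Plat _ (vert_vertex Pv vsep j).
have dotz (a b : 'rV[int]_n) : dot (lv a) (lv b) = (\sum_k a 0 k * b 0 k)%:~R :> R.
  by rewrite /dot rmorph_sum; apply: eq_bigr => k _; rewrite rmorphM !mxE.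
have cinv : c^-1 = (\sum_k z 0 k * al j i 0 k)%:~R.
  by rewrite -dotz -yz yx co_al eqxx mulr1.
have cint : c = (- coz j w i)%:~R by rewrite /c vw co_lv rmorphN.
move: cinv cint; set p := \sum_k _; set q := - _ => pE qE.
have pq : p * q = 1.
  by apply/eqP; rewrite -(eqr_int R) rmorphM /= -pE -qE mulVf ?(gt_eqF c0).
have q0 : 0 < q by rewrite -(ltr_int R) -qE.
have p0 : 0 < p by rewrite -(pmulr_lgt0 _ q0) pq.
have q1 : q = 1 by nia.
by rewrite -[LHS]opprK -/c qE q1 mulr1z.
Qed.

Lemma vertE j : v j = - \sum_k lv (al j k).
Proof.
rewrite {1}(coK j (v j)) -sumrN; apply: eq_bigr => k _.
by rewrite vert_coN1 scaleN1r.
Qed.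

(** * Lattice lengths of edges and the Chern numbers *)

Section Lengths.
Variables (nx : 'I_N -> 'I_n -> 'I_n -> 'I_n) (ch : 'I_N -> 'I_n -> 'I_n -> int).
Hypothesis nxT : forall j i k, al (nb j i) (nx j i k) = al j k - ch j i k *: al j i.
Hypothesis nxK : forall j i k, nx (nb j i) (nx j i i) (nx j i k) = k.

(** Subtract the formulas [vertE] at the two ends, matching edges by the bijection [nx j i]; each
    matched pair contributes its Chern number times the edge vector. *)
Lemma len_sum j i : ln j i = (\sum_k ch j i k)%:~R.
Proof.
have nx_inj : injective (nx j i) by move=> k k' e; rewrite -(nxK j i k) e nxK.
have e : ln j i *: lv (al j i) = (\sum_k ch j i k)%:~R *: lv (al j i).
  rewrite -edgeE !vertE opprK addrC [X in _ - X](reindex_inj nx_inj) /= -sumrB.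
  rewrite rmorph_sum scaler_suml; apply: eq_bigr => k _.
  by rewrite nxT; apply/rowP => l; rewrite !mxE rmorphB rmorphM /=; ring.
by have := congr1 (fun x => co j x i) e; rewrite /= !coZ co_al eqxx !mulr1.
Qed.

Lemma len_gt0 j i : 0 < \sum_k ch j i k.
Proof. by rewrite -(ltr_int R) -len_sum. Qed.

(** With L and L' the lengths of the [i]-th edge and of [nabla] of the [k]-th, the far end of the
    latter has [i]-th coordinate L - c L' relative to [v j]. It is non-negative, and L and L' are
    positive integers. *)
Lemma chern_le_len j i k : k != i -> ch j i k <= \sum_k ch j i k.
Proof.
move=> ki; set q := nb j i; set k' := nx j i k.
have := cone_co j i (vert_in Pv (nb q k')).
rewrite -[v (nb q k')](subrK (v q)) -addrA coD !edgeE nxT.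
have -> : lv (al j k - ch j i k *: al j i)
    = lv (al j k) - (ch j i k)%:~R *: lv (al j i) :> 'rV[R]_n.
  by apply/rowP => l; rewrite !mxE rmorphB rmorphM.
rewrite !(coZ, coB) !co_al eqxx (negPf ki) !mulr1 sub0r !len_sum -!(rmorphN, rmorphM, rmorphD).
rewrite ler0z; have := len_gt0 q k'; have := len_gt0 j i.
set L := \sum_k0 ch j i _; set L' := \sum_k0 ch q _ _; set c := ch j i k.
nia.
Qed.

Hypothesis nbK : forall j i, nb (nb j i) (nx j i i) = j.
Hypothesis ch_diag : forall j i, ch j i i = 2.

Lemma al_generic : exists f : 'rV[int]_n, forall j i, dotz (al j i) f != 0.
Proof.
have [a|f fP] := @generic_vector n [seq al t.1 t.2 | t <- enum {: 'I_N * 'I_n}].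
  by case/mapP => t _ ->; exact: al_neq0.
exists f => j i; apply: fP.
by apply/mapP; exists (j, i); rewrite ?mem_enum.
Qed.

Lemma sum_sgz (f : 'rV[int]_n) j : (forall i, dotz (al j i) f != 0) ->
  \sum_i sgz (dotz (al j i) f) = n%:Z - 2 * #|desc (lv f) j|%:Z.
Proof.
move=> f0; have -> : n%:Z = \sum_(i < n) 1 by rewrite sumr_const card_ord natz.
have -> : #|desc (lv f) j|%:Z = \sum_i (i \in desc (lv f) j)%:R :> int.
  by rewrite -sum1_card big_mkcond -natz natr_sum; apply: eq_bigr => i _; case: ifP.
rewrite mulr_sumr -sumrB.
apply: eq_bigr => i _; rewrite inE dot_lattice_vec ltrz0.
have -> : dotz f (al j i) = dotz (al j i) f.
  by rewrite /dotz !mxE; apply: eq_bigr => k _; rewrite !mxE mulrC.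
by case: sgzP (f0 i).
Qed.

Lemma desc_opp (f : 'rV[R]_n) j : (forall i, dot f (lv (al j i)) != 0) ->
  #|desc (- f) j| = (n - #|desc f j|)%N.
Proof.
move=> f0; rewrite cardsCs card_ord; congr (n - #|pred_of_set _|)%N.
by apply/setP => i; rewrite !inE dotNl oppr_lt0 -leNgt le_eqVlt (negPf (f0 i)).
Qed.

Variable h : 'I_n.+1 -> nat.
Hypothesis Ph : has_h_vector P h.
Hypothesis n_ge3 : (3 <= n)%N.

(** The factor 2 appears because every edge is counted from both ends. *)
Lemma sum_len : \sum_j \sum_i (\sum_k ch j i k)%:~R = 2 * chern_bound h :> rat.
Proof.
have [f fP] := al_generic.
pose x j i := dotz (al j i) f.
(* A functional nonzero on these vectors makes the determinants of [x] and [y] nonzero off the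
   diagonal. *)
have [a|g gP] := @generic_vector n
    [seq x t.1.1 t.1.2 *: al t.1.1 t.2 - x t.1.1 t.2 *: al t.1.1 t.1.2
      | t <- enum [pred t : 'I_N * 'I_n * 'I_n | t.1.2 != t.2]].
  case/mapP => -[[j i] k]; rewrite mem_enum inE /= => ik ->.
  apply/eqP => /(congr1 (fun a => coz j a k)).
  rewrite cozB !cozZ !coz_al eqxx (negPf ik) mulr1 mulr0 subr0 /coz mul0mx mxE => /eqP.
  exact/negP/fP.
pose y j i := dotz (al j i) g.
have xT j i k : x (nb j i) (nx j i k) = x j k - ch j i k * x j i.
  by rewrite /x nxT dotzBl dotzZl.
have yT j i k : y (nb j i) (nx j i k) = y j k - ch j i k * y j i.
  by rewrite /y nxT dotzBl dotzZl.
have xy0 j i k : i != k -> x j i * y j k - x j k * y j i != 0.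
  move=> ik; rewrite /y -!dotzZl -dotzBl; apply: gP.
  by apply/mapP; exists (j, i, k); rewrite ?mem_enum.
under eq_bigr => j _ do under eq_bigr => i _ do rewrite rmorph_sum /=.
rewrite (sum_connection nbK nxK ch_diag xT yT fP xy0) (chern_boundE Ph (ltnW n_ge3)).
have f0 j i : dot (lv f) (lv (al j i)) != 0.
  rewrite dotC dot_lattice_vec intr_eq0; exact: fP.
have f0' j i : dot (- lv f) (lv (al j i)) != 0 by rewrite dotNl oppr_eq0.
(* Counting 2-faces with [f] and with [- f] symmetrizes in k and n - k, where k is the number of
   descending edges. The claim then holds vertex by vertex: 3(n-2k)^2 - n = 6k(k-1) + 6(n-k)(n-k-1)
   + 5n - 3n^2. *)
have F2 : (face_count P 2)%:R * 2 = \sum_j ('C(#|desc (lv f) j|, 2)%:R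
    + 'C(n - #|desc (lv f) j|, 2)%:R) :> rat.
  rewrite mulr_natr mulr2n {1}(face_count_desc f0) (face_count_desc f0') !natr_sum -big_split.
  by apply: eq_bigr => j _; rewrite desc_opp.
rewrite (face_count_desc f0 0) natr_sum mulrDr.
have -> : 2 * (12 * (face_count P 2)%:R) = 12 * ((face_count P 2)%:R * 2) :> rat by ring.
rewrite F2 !mulr_sumr -big_split /=; apply: eq_bigr => j _.
rewrite (sum_sgz (fP j)) !bin2R bin0 natrB; last by rewrite -[X in (_ <= X)%N]card_ord max_card.
by rewrite rmorphB rmorphM /= -!pmulrn; field.
Qed.

(** The edge occurs twice in [sum_len], once from each end, and the positive length of the adjacent
    [k]-th edge makes the inequality strict. *)
Lemma len_lt j i k : k != i -> (\sum_k ch j i k)%:~R < chern_bound h.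
Proof.
move=> ki; have [i' [e ei]] := rev_edge j i.
pose L (t : 'I_N * 'I_n) : int := \sum_k ch t.1 t.2 k.
have L0 t : 0 < (L t)%:~R :> rat by rewrite ltr0z len_gt0.
have jq : nb j i != j.
  have : is_edge P (v j) (v (nb j i)) by apply/nbP; exists i.
  by move/edge_neq; apply: contraNneq => ->.
have Le : L (nb j i, i') = L (j, i).
  by apply/eqP; rewrite -(eqr_int R) -!len_sum (ln_rev e ei).
have := sum_len; rewrite (pair_bigA _ (fun j i => (L (j, i))%:~R)) /=.
rewrite (bigD1 (j, i)) //= (bigD1 (nb j i, i')) /=; last by rewrite xpair_eqE (negPf jq).
rewrite (bigD1 (j, k)) /=; last first.
  by rewrite !xpair_eqE [j == nb j i]eq_sym (negPf jq) (negPf ki) andbF.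
rewrite Le -[\sum_k ch j i k]/(L (j, i)); set S := \sum_(t | _) _ => E.
have S0 : 0 <= S by rewrite sumr_ge0 // => t _; rewrite ltW.
have := L0 (j, k); lra.
Qed.

(** For the lower bound, split the length L of the edge into 2, the number c in question and n - 2
    further Chern numbers, each at most L. Hence c >= (3 - n) L - 2, and L < C with n >= 3
    finishes. *)
Lemma chern_bounds j i k : k != i ->
  (3 - n%:R) * chern_bound h - 2 <= (ch j i k)%:~R :> rat /\
  (ch j i k)%:~R < chern_bound h.
Proof.
move=> ki; have LC := len_lt j ki.
have cL := chern_le_len j ki.
have up : (ch j i k)%:~R <= (\sum_k ch j i k)%:~R :> rat by rewrite ler_int.
split; last exact: le_lt_trans LC.
set L := \sum_k _ in LC cL up.
have : L <= 2 + ch j i k + (n%:Z - 2) * L.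
  rewrite {1}/L (bigD1 i) //= (bigD1 k) //= ch_diag addrA lerD2l.
  have -> : (n%:Z - 2) * L = \sum_(l < n | (l != i) && (l != k)) L.
    rewrite sumr_const -[RHS]mulr_natl; congr (_ * _).
    have c := cardC (pred2 i k); rewrite card_ord card2 eq_sym ki in c.
    rewrite natz -[LHS]/(n%:Z - 2%:Z); move: c; rewrite (eq_card (B := [predC pred2 i k])).
      by move: #|_| => m /= c; lia.
    by move=> l; rewrite !inE negb_or.
  by apply: ler_sum => l /andP[li _]; exact: chern_le_len.
rewrite -(ler_int rat) !(rmorphD, rmorphM, rmorphB) /= -pmulrn => H.
have n3 : 3 <= n%:R :> rat by rewrite ler_nat.
nra.
Qed.

End Lengths.

End Smooth.

(** * The bounds *)

Lemma smooth_data (R : realType) (n : nat) (P : set 'rV[R]_n) : is_smooth P ->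
  exists N (v : 'I_N -> 'rV[R]_n) (nb : 'I_N -> 'I_n -> 'I_N)
    (B D : 'I_N -> 'M[int]_n) (ln : 'I_N -> 'I_n -> R),
  [/\ P = convex_hull (range v),
      forall j, exists l, forall k, k != j -> 0 < dot l (v k - v j),
      forall j r, is_edge P (v j) (v r) <-> exists i, r = nb j i,
      forall j, B j *m D j = 1%:M /\ D j *m B j = 1%:M &
      forall j i, [/\ is_primitive (row i (B j)), 0 < ln j i &
        v (nb j i) - v j = ln j i *: lattice_vec (row i (B j))]].
Proof.
case=> [[Ppoly _] _ sm].
have [N [v [Pv vsep]]] := polytope_vertices Ppoly.
have vv := vert_vertex Pv vsep.
have loc j : exists d : ('I_n -> 'I_N) * 'M[int]_n * 'M[int]_n * ('I_n -> R),
  [/\ forall r, is_edge P (v j) (v r) <-> exists i, r = d.1.1.1 i,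
      d.1.1.2 *m d.1.2 = 1%:M /\ d.1.2 *m d.1.1.2 = 1%:M &
      forall i, [/\ is_primitive (row i d.1.1.2), 0 < d.2 i &
        v (d.1.1.1 i) - v j = d.2 i *: lattice_vec (row i d.1.1.2)]].
  have [q [B [qinj qE qp /rows_Zbasis_inv[D BD DB]]]] := sm _ (vv j).
  have /choice[nb nbE] i : exists r, q i = v r.
    by apply: (edge_vert Pv (p := v j)); apply/qE; exists i.
  have /choice[ln lnP] i : exists t : R, 0 < t /\ q i - v j = t *: lattice_vec (row i B).
    by have [_ [t t0 e]] := qp i; exists t.
  exists (nb, B, D, ln); split=> //= [r|i].
    split=> [/qE[i e]|[i ->]]; last by apply/qE; exists i.
    by exists i; apply: (vert_inj vsep); rewrite e nbE.
  by have [? e] := lnP i; have [pr _] := qp i; split=> //; rewrite -nbE.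
have [d dP] := choice loc.
exists N, v, (fun j => (d j).1.1.1), (fun j => (d j).1.1.2), (fun j => (d j).1.2).
exists (fun j => (d j).2).
by split=> // [j|j|j]; have [] := dP j.
Qed.

Lemma finite_int_interval (a b : rat) :
  finite_set [set c : int | a <= c%:~R /\ c%:~R < b].
Proof.
pose M := Num.bound (`|a| + `|b|).
have MP : `|a| + `|b| < M%:R by apply: archi_boundP; rewrite addr_ge0.
apply: (@sub_finite_set _ _ ([set` [seq Posz i | i <- iota 0 M]] `|`
    [set` [seq - Posz i | i <- iota 0 M]])).
  move=> c [ac cb]; have cM : (absz c < M)%N.
    rewrite -(ltr_nat rat) natr_absz intr_norm (le_lt_trans _ MP) //.
    rewrite ler_norml; have := ler_norm b; have := ler_norm (- a); rewrite normrN.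
    have := normr_ge0 a; have := normr_ge0 b; lra.
  have [c0|c0] := lerP 0 c; [left|right].
    by apply/mapP; exists (absz c); rewrite ?mem_iota // gez0_abs.
  by apply/mapP; exists (absz c); rewrite ?mem_iota // ltz0_abs // opprK.
by rewrite finite_setU; split; apply/finite_seqP; eexists.
Qed.

Lemma line_chern_bounds (R : realType) (n : nat) (h : 'I_n.+1 -> nat)
    (P : set 'rV[R]_n) p q r c : (3 <= n)%N ->
  is_smooth P -> is_reflexive P -> has_h_vector P h -> is_line_chern P p q r c ->
  (3 - n%:R) * chern_bound h - 2 <= c%:~R /\ c%:~R < chern_bound h.
Proof.
move=> n3 /smooth_data[N [v [nb [B [D [ln [Pv vsep nbP BDB loc]]]]]]] refl Ph.
have BD j : B j *m D j = 1%:M by case: (BDB j).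
have DB j : D j *m B j = 1%:M by case: (BDB j).
have prim j i : is_primitive (row i (B j)) by case: (loc j i).
have ln_gt0 j i : 0 < ln j i by case: (loc j i).
have edgeE j i : v (nb j i) - v j = ln j i *: lattice_vec (row i (B j)) by case: (loc j i).
have [nx [ch [nxT nbK nxK ch_diag nxU]]] :=
  connection_exists Pv vsep nbP BD DB prim ln_gt0 edgeE.
move=> [F [s [ae [af [ag [[epq epr qr] _ [eqs _ _] [pae paf pag] e]]]]]].
(* End points of edges are listed vertices, so all points and primitive vectors become indices and
   rows of the edge bases. *)
have [j pj] := edge_vert Pv (edgeC epq); rewrite {}pj in epq epr pae paf.
have [j' qj] := edge_vert Pv epq; rewrite {}qj in epq qr eqs pae pag.
have [i ji] := (nbP _ _).1 epq; rewrite {}ji in epq qr eqs pae pag.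
have [j'' rj] := edge_vert Pv epr; rewrite {}rj in epr qr paf.
have [k jk] := (nbP _ _).1 epr; rewrite {}jk in epr qr paf.
have [j3 sj] := edge_vert Pv eqs; rewrite {}sj in eqs pag.
have [m jm] := (nbP _ _).1 eqs; rewrite {}jm in eqs pag.
have al := primitive_along_al prim ln_gt0 edgeE.
move: e; rewrite (al _ _ _ pae) (al _ _ _ paf) (al _ _ _ pag) => e.
have [_ ->] := nxU j i m k c ltac:(by rewrite -e opprB addrC subrK).
apply: (chern_bounds Pv vsep nbP BD DB prim ln_gt0 edgeE refl nxT nxK nbK ch_diag Ph n3).
by apply: contra_notN qr => /eqP ->.
Qed.

Theorem corollary6p2 (R : realType) (n : nat) (h : 'I_n.+1 -> nat)
    (hn : (3 <= n)%N) :
  finite_set [set c : int | exists (P : set 'rV[R]_n) (p q r : 'rV[R]_n),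
    [/\ is_smooth P, is_reflexive P, has_h_vector P h
      & is_line_chern P p q r c]]
  /\
  (forall (P : set 'rV[R]_n) (p q r : 'rV[R]_n) (c : int),
    is_smooth P -> is_reflexive P -> has_h_vector P h ->
    is_line_chern P p q r c ->
    (3 - n%:R) * chern_bound h - 2 <= c%:~R /\ c%:~R < chern_bound h).
Proof.
split; last by move=> P p q r c; exact: line_chern_bounds.
apply: sub_finite_set (@finite_int_interval
  ((3 - n%:R) * chern_bound h - 2) (chern_bound h)) => c [P [p [q [r [sP rP hP cP]]]]].
exact: line_chern_bounds sP rP hP cP.
Qed.
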